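(* Let $M$ be a graded $S$-module of finite length with minimal free resolution $\mathbf{F}$. Then for all integers $a$ with $|a|\gg 0$ (i.e. there is an $N$ such that for all $a$ with $|a|>N$), every free degree $a$ differential module $D$ with homology $M$ is quasi-isomorphic to the minimal free resolution $\mathbf{F}$ of $M$, regarded as the degree $a$ differential module $\operatorname{Fold}^a(\mathbf{F})$.
   Context: $S$ is a Noetherian graded-local ring: an $\mathbb{N}$-graded ring (possibly concentrated in degree $0$) whose degree $0$ component is local, with residue field $\Bbbk$. All modules are finitely generated. A differential module $(D,d)$ is an $S$-module $D$ with an $S$-endomorphism $d$ such that $d^2=0$. It is of degree $a$ if $D$ is graded and $d\colon D\to D(a)$ is a graded map; its homology is $H(D)=\ker(d)/\operatorname{im}(d(-a))$. It is free if the underlying module $D$ is free. Morphisms are graded $S$-module maps commuting with the endomorphisms, and a quasi-isomorphism is a morphism inducing an isomorphism on homology. For a homogeneous complex $(C_\bullet,\partial)$ (differentials of degree $0$), $\operatorname{Fold}^a(C_\bullet)$ is the degree $a$ differential module $(\bigoplus_i C_i(ia),\partial)$. *)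

(* Defs.v *)
From HB Require Import structures.
From Stdlib Require Import Relations.
From mathcomp Require Import all_boot all_order all_algebra.
From mathcomp Require Import generic_quotient ring_quotient.
From mathcomp Require Import boolp classical_sets.

Set Implicit Arguments.
Unset Strict Implicit.
Unset Printing Implicit Defensive.

Import Order.TTheory GRing.Theory Num.Theory.
Local Open Scope ring_scope.

(* V is the internal direct sum of the subgroups comp i. *)
Record is_grading (I : eqType) (V : zmodType) (comp : I -> set V) : Prop := {
  grading0 : forall i, comp i 0;
  gradingB : forall i x y, comp i x -> comp i y -> comp i (x - y);
  grading_span : forall x, exists (s : seq I) (c : I -> V),
    [/\ uniq s, forall i, comp i (c i) & x = \sum_(i <- s) c i];
  grading_indep : forall (s : seq I) (c : I -> V),
    uniq s -> (forall i, comp i (c i)) -> \sum_(i <- s) c i = 0 ->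
    forall i, i \in s -> c i = 0 }.

Record gradedRing := GradedRing {
  gring_sort :> comNzRingType;
  gring_comp : nat -> set gring_sort;
  gring_grading : is_grading gring_comp;
  gring_comp1 : gring_comp 0 1;
  gring_compM : forall i j x y,
    gring_comp i x -> gring_comp j y -> gring_comp (i + j)%N (x * y) }.

Record gradedModule (S : gradedRing) := GradedModule {
  gmod_sort :> lmodType S;
  gmod_comp : int -> set gmod_sort;
  gmod_grading : is_grading gmod_comp;
  gmod_compZ : forall i n (r : S) (x : gmod_sort),
    gring_comp i r -> gmod_comp n x -> gmod_comp (i%:Z + n) (r *: x) }.

Arguments gmod_comp {S} M n : rename.

Definition graded_map (S : gradedRing) (M N : gradedModule S) (f : M -> N) :=
  forall n x, gmod_comp M n x -> gmod_comp N n (f x).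

(* A bijective linear map of degree 0 has an inverse of degree 0. *)
Definition graded_iso (S : gradedRing) (M N : gradedModule S) :=
  exists f : {linear M -> N}, bijective f /\ graded_map f.

Record ideal_in (R : comNzRingType) (A I : set R) : Prop := {
  ideal_in_sub : forall x, I x -> A x;
  ideal_in0 : I 0;
  ideal_inD : forall x y, I x -> I y -> I (x + y);
  ideal_inM : forall r x, A r -> I x -> I (r * x) }.

Definition maximal_ideal_in (R : comNzRingType) (A m : set R) :=
  [/\ ideal_in A m, ~ m 1 &
      forall J, ideal_in A J -> (forall x, m x -> J x) -> ~ J 1 ->
        forall x, J x -> m x].

Definition noetherian (R : comNzRingType) :=
  forall I : set R, ideal_in setT I -> exists s : seq R,
    forall x, I x <-> exists c : nat -> R, x = \sum_(i < size s) c i * s`_i.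

Record gradedLocalRing := GradedLocalRing {
  glr_ring :> gradedRing;
  glr_max0 : set glr_ring;
  glr_max0P : maximal_ideal_in (gring_comp (g:=glr_ring) 0) glr_max0;
  glr_max0_uniq : forall m,
    maximal_ideal_in (gring_comp (g:=glr_ring) 0) m -> m = glr_max0 }.

(* The homogeneous maximal ideal: the maximal ideal of S_0 plus all
   components of positive degree. *)
Definition glr_max (S : gradedLocalRing) : set S := fun x =>
  exists (n : nat) (c : nat -> S),
    [/\ forall i, gring_comp i (c i), glr_max0 (c 0%N)
      & x = \sum_(i < n) c i].

Definition fin_gen (R : nzRingType) (V : lmodType R) :=
  exists s : seq V, forall x, exists c : nat -> R,
    x = \sum_(i < size s) c i *: s`_i.

Record is_submodule (R : nzRingType) (V : lmodType R) (W : set V) : Prop := {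
  submodule0 : W 0;
  submoduleD : forall x y, W x -> W y -> W (x + y);
  submoduleZ : forall (r : R) x, W x -> W (r *: x) }.

(* The supremum of the lengths of strict chains of submodules is finite. *)
Definition finite_length (R : nzRingType) (V : lmodType R) :=
  exists l : nat, forall (n : nat) (W : nat -> set V),
    (forall i, (i <= n)%N -> is_submodule (W i)) ->
    (forall i, (i < n)%N -> W i `<` W i.+1)%classic ->
    (n <= l)%N.

Definition is_basis (R : nzRingType) (V : lmodType R) (n : nat)
    (e : 'I_n -> V) :=
  forall x, exists! c : {ffun 'I_n -> R}, x = \sum_i c i *: e i.

(* Over a nonzero commutative ring: finitely generated and free. The basis
   need not be homogeneous. *)
Definition fin_free (R : nzRingType) (V : lmodType R) :=
  exists (n : nat) (e : 'I_n -> V), is_basis e.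

(* M is isomorphic to the direct sum of the shifts S(-b i). *)
Definition graded_fin_free (S : gradedRing) (M : gradedModule S) :=
  exists (n : nat) (e : 'I_n -> M) (b : 'I_n -> int),
    is_basis e /\ forall i, gmod_comp M (b i) (e i).

Lemma is_grading_shift (V : zmodType) (comp : int -> set V) (a : int) :
  is_grading comp -> is_grading (fun n => comp (n + a)).
Proof.
move=> [g0 gB gS gI]; split=> //.
- by move=> n x y; apply: gB.
- move=> x; have [s [c [us cc ->]]] := gS x.
  exists [seq (i : int) - a | i <- s], (fun n : int => c (n + a)); split=> //.
    by rewrite map_inj_uniq //; apply: addIr.
  by rewrite big_map; apply: eq_bigr => i _; rewrite subrK.
- move=> s c us cc sc i si.
  rewrite -[i](addrK a).
  apply: (gI [seq (i : int) + a | i <- s] (fun n : int => c (n - a))) => //.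
  + by rewrite map_inj_uniq //; apply: addIr.
  + by move=> j; have := cc (j - a); rewrite subrK.
  + by rewrite -{}[RHS]sc big_map; apply: eq_bigr => j _; rewrite addrK.
  + exact: map_f.
Qed.

(* M(a)_n = M_(n + a) *)
Definition gmod_shift (S : gradedRing) (a : int) (M : gradedModule S) :
  gradedModule S.
Proof.
refine (@GradedModule S M (fun n => gmod_comp M (n + a))
          (is_grading_shift a (gmod_grading M)) _).
by move=> i n r x Sr Mx; rewrite -addrA; apply: gmod_compZ.
Defined.

Record dsum (R : nzRingType) (F : nat -> lmodType R) := DSum {
  dsum_fun :> forall i, F i;
  dsum_fin : exists n, forall i, (n <= i)%N -> dsum_fun i = 0 }.

HB.instance Definition _ (R : nzRingType) (F : nat -> lmodType R) :=
  gen_eqMixin (dsum F).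
HB.instance Definition _ (R : nzRingType) (F : nat -> lmodType R) :=
  gen_choiceMixin (dsum F).

Lemma dsumP (R : nzRingType) (F : nat -> lmodType R) (x y : dsum F) :
  (forall i, x i = y i) -> x = y.
Proof.
case: x y => [x hx] [y hy] /= exy.
have e : x = y by apply: functional_extensionality_dep.
by case: _ / e hy => hy; congr DSum; apply: Prop_irrelevance.
Qed.

Definition dsum0 (R : nzRingType) (F : nat -> lmodType R) : dsum F.
Proof. by exists (fun i => 0); exists 0%N. Defined.

Definition dsum_opp (R : nzRingType) (F : nat -> lmodType R) (x : dsum F) :
  dsum F.
Proof.
exists (fun i => - x i); case: (dsum_fin x) => n h.
by exists n => i /h ->; rewrite oppr0.
Defined.

Definition dsum_add (R : nzRingType) (F : nat -> lmodType R) (x y : dsum F) :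
  dsum F.
Proof.
exists (fun i => x i + y i).
case: (dsum_fin x) (dsum_fin y) => n h [m k]; exists (maxn n m) => i.
by rewrite geq_max => /andP[/h -> /k ->]; rewrite addr0.
Defined.

Definition dsum_scale (R : nzRingType) (F : nat -> lmodType R) (r : R)
  (x : dsum F) : dsum F.
Proof.
exists (fun i => r *: x i); case: (dsum_fin x) => n h.
by exists n => i /h ->; rewrite scaler0.
Defined.

Lemma dsum_addA (R : nzRingType) (F : nat -> lmodType R) :
  associative (@dsum_add R F).
Proof. by move=> x y z; apply: dsumP => i /=; rewrite addrA. Qed.
Lemma dsum_addC (R : nzRingType) (F : nat -> lmodType R) :
  commutative (@dsum_add R F).
Proof. by move=> x y; apply: dsumP => i /=; rewrite addrC. Qed.
Lemma dsum_add0 (R : nzRingType) (F : nat -> lmodType R) :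
  left_id (dsum0 F) (@dsum_add R F).
Proof. by move=> x; apply: dsumP => i /=; rewrite add0r. Qed.
Lemma dsum_addN (R : nzRingType) (F : nat -> lmodType R) :
  left_inverse (dsum0 F) (@dsum_opp R F) (@dsum_add R F).
Proof. by move=> x; apply: dsumP => i /=; rewrite addNr. Qed.

HB.instance Definition _ (R : nzRingType) (F : nat -> lmodType R) :=
  GRing.isZmodule.Build (dsum F) (@dsum_addA R F) (@dsum_addC R F)
    (@dsum_add0 R F) (@dsum_addN R F).

Lemma dsum_scaleA (R : nzRingType) (F : nat -> lmodType R) (a b : R)
  (x : dsum F) : dsum_scale a (dsum_scale b x) = dsum_scale (a * b) x.
Proof. by apply: dsumP => i /=; rewrite scalerA. Qed.
Lemma dsum_scale1 (R : nzRingType) (F : nat -> lmodType R) :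
  left_id 1 (@dsum_scale R F).
Proof. by move=> x; apply: dsumP => i /=; rewrite scale1r. Qed.
Lemma dsum_scaleDr (R : nzRingType) (F : nat -> lmodType R) :
  right_distributive (@dsum_scale R F) +%R.
Proof. by move=> a x y; apply: dsumP => i /=; rewrite scalerDr. Qed.
Lemma dsum_scaleDl (R : nzRingType) (F : nat -> lmodType R) (x : dsum F) :
  {morph (@dsum_scale R F)^~ x : a b / a + b}.
Proof. by move=> a b; apply: dsumP => i /=; rewrite scalerDl. Qed.

HB.instance Definition _ (R : nzRingType) (F : nat -> lmodType R) :=
  GRing.Zmodule_isLmodule.Build R (dsum F) (@dsum_scaleA R F)
    (@dsum_scale1 R F) (@dsum_scaleDr R F) (@dsum_scaleDl R F).

Lemma dsum_sumE (R : nzRingType) (F : nat -> lmodType R) (I : Type)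
  (s : seq I) (c : I -> dsum F) i :
  (\sum_(j <- s) c j : dsum F) i = \sum_(j <- s) c j i.
Proof. by elim: s => [|j s IH]; rewrite ?big_nil // !big_cons /= -IH. Qed.

Lemma big_extend (V : zmodType) (I : eqType) (s t : seq I) (c : I -> V) :
  uniq s -> uniq t -> {subset s <= t} -> (forall i, i \notin s -> c i = 0) ->
  \sum_(i <- t) c i = \sum_(i <- s) c i.
Proof.
move=> us ut st c0.
rewrite (bigID (mem s)) /= [X in _ + X]big1 ?addr0; last by move=> i /c0.
rewrite -big_filter; apply: perm_big; apply: uniq_perm => //.
  exact: filter_uniq.
by move=> i; rewrite mem_filter; case si: (i \in s) => //=; rewrite st.
Qed.

Lemma is_grading_dsum (R : nzRingType) (F : nat -> lmodType R) (I : eqType)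
  (comp : forall i, I -> set (F i)) : (forall i, is_grading (comp i)) ->
  is_grading (fun n (x : dsum F) => forall i, comp i n (x i)).
Proof.
move=> gF; split.
- by move=> n i; apply: grading0.
- by move=> n x y hx hy i; apply: gradingB.
- move=> x; have [N hN] := dsum_fin x.
  have H i : exists sc : seq I * (I -> F i), [/\ uniq sc.1,
      forall n, comp i n (sc.2 n), forall n, n \notin sc.1 -> sc.2 n = 0
      & x i = \sum_(n <- sc.1) sc.2 n].
    have [s [c [us cc ->]]] := grading_span (gF i) (x i).
    exists (s, fun n => if n \in s then c n else 0); split=> //=.
    + by move=> n; case: ifP => _ //; apply: grading0.
    + by move=> n /negbTE ->.
    + by apply: eq_big_seq => n ->.
  pose sc i := projT1 (cid (H i)).
  have scP i := projT2 (cid (H i)).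
  pose t := undup (flatten [seq (sc i).1 | i <- iota 0 N]).
  have fin n : exists m, forall i, (m <= i)%N ->
      (if (i < N)%N then (sc i).2 n else 0 : F i) = 0.
    by exists N => i; rewrite leqNgt => /negbTE ->.
  exists t, (fun n => DSum (fin n)); split; first exact: undup_uniq.
    move=> n i /=; case: ifP => _; last exact: grading0.
    by case: (scP i) => _ /(_ n).
  apply: dsumP => i; rewrite dsum_sumE /=; case: ltnP => [iN|/hN->]; last first.
    by rewrite big1.
  case: (scP i) => us _ c0 ->; rewrite -/(sc i).
  apply/esym/(big_extend us); rewrite ?undup_uniq // => n sn.
  rewrite mem_undup; apply/flattenP; exists (sc i).1 => //.
  by apply: (map_f (fun j => (sc j).1)); rewrite mem_iota.
- move=> s c us cc sc n sn; apply: dsumP => i.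
  apply: (grading_indep (gF i) us (c := fun n => c n i)) => //.
  by rewrite -dsum_sumE sc.
Qed.

Definition gdsum (S : gradedRing) (F : nat -> gradedModule S) :
  gradedModule S.
Proof.
refine (@GradedModule S (dsum (fun i => gmod_sort (F i)))
          (fun n x => forall i, gmod_comp (F i) n (x i))
          (is_grading_dsum (fun i => gmod_grading (F i))) _).
by move=> i n r x Sr Fx j; apply: gmod_compZ.
Defined.

Record diffModule (S : gradedRing) (a : int) := DiffModule {
  dmod_sort :> gradedModule S;
  dmod_d : {linear dmod_sort -> dmod_sort};
  dmod_deg : graded_map (N := gmod_shift a dmod_sort) dmod_d;
  dmod_dd : forall x, dmod_d (dmod_d x) = 0 }.

Arguments dmod_d {S a} D : rename.

Definition cycle_pred (S : gradedRing) (a : int) (D : diffModule S a) :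
  {pred D} := fun x => dmod_d D x == 0.
Arguments cycle_pred {S a} D _ : rename.

Lemma cycle_pred_closed (S : gradedRing) (a : int) (D : diffModule S a) :
  submod_closed (cycle_pred D).
Proof.
split=> [|r x y]; rewrite !unfold_in ?linear0 // => /eqP hx /eqP hy.
by rewrite linearP hx hy scaler0 addr0.
Qed.

HB.instance Definition _ (S : gradedRing) (a : int) (D : diffModule S a) :=
  GRing.isSubmodClosed.Build S D (cycle_pred D) (cycle_pred_closed D).

Record cycles (S : gradedRing) (a : int) (D : diffModule S a) := Cycle {
  cycle_val :> D;
  cycle_valP : cycle_val \in cycle_pred D }.

HB.instance Definition _ (S : gradedRing) (a : int) (D : diffModule S a) :=
  [isSub of cycles D for @cycle_val S a D].
HB.instance Definition _ (S : gradedRing) (a : int) (D : diffModule S a) :=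
  [Choice of cycles D by <:].
HB.instance Definition _ (S : gradedRing) (a : int) (D : diffModule S a) :=
  [SubChoice_isSubLmodule of cycles D by <:].

Definition boundary_pred (S : gradedRing) (a : int) (D : diffModule S a) :
  {pred cycles D} := fun z => `[< exists y : D, val z = dmod_d D y >].
Arguments boundary_pred {S a} D _ : rename.

Lemma boundary_pred_closed (S : gradedRing) (a : int) (D : diffModule S a) :
  submod_closed (boundary_pred D).
Proof.
split=> [|r x y]; rewrite !unfold_in.
  by apply/asboolP; exists 0; rewrite [RHS]linear0.
move=> /asboolP[x' hx] /asboolP[y' hy]; apply/asboolP; exists (r *: x' + y').
by rewrite linearP -hx -hy.
Qed.

HB.instance Definition _ (S : gradedRing) (a : int) (D : diffModule S a) :=
  GRing.isSubmodClosed.Build S (cycles D) (boundary_pred D)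
    (boundary_pred_closed D).

Definition homology (S : gradedRing) (a : int) (D : diffModule S a) :=
  Quotient.quot (boundary_pred D).

HB.instance Definition _ (S : gradedRing) (a : int) (D : diffModule S a) :=
  GRing.Zmodule.on (homology D).

Definition homology_class (S : gradedRing) (a : int) (D : diffModule S a)
  (z : cycles D) : homology D := \pi_(Quotient.quot (boundary_pred D))%qT z.

Lemma homology_classE (S : gradedRing) (a : int) (D : diffModule S a)
  (z w : cycles D) :
  homology_class z = homology_class w <->
  exists y : D, cycle_val z - cycle_val w = dmod_d D y.
Proof.
split=> [/eqP|h]; last apply/eqP; rewrite /homology_class -Quotient.idealrBE.
  by rewrite unfold_in => /asboolP[y hy]; exists y.
by rewrite unfold_in; apply/asboolP; case: h => y hy; exists y.
Qed.

Lemma homology_classP (S : gradedRing) (a : int) (D : diffModule S a)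
  (h : homology D) : homology_class (repr h) = h.
Proof. exact: reprK. Qed.

Lemma homology_classD (S : gradedRing) (a : int) (D : diffModule S a)
  (z w : cycles D) :
  homology_class (z + w) = homology_class z + homology_class w.
Proof. exact: (raddfD (\pi_(Quotient.quot (boundary_pred D))%qT)). Qed.

Lemma homology_class0 (S : gradedRing) (a : int) (D : diffModule S a) :
  homology_class (0 : cycles D) = 0.
Proof. exact: (raddf0 (\pi_(Quotient.quot (boundary_pred D))%qT)). Qed.

Definition homology_scale (S : gradedRing) (a : int) (D : diffModule S a)
  (r : S) (h : homology D) : homology D := homology_class (r *: repr h).

Lemma homology_scaleE (S : gradedRing) (a : int) (D : diffModule S a)
  (r : S) (z : cycles D) :
  homology_scale r (homology_class z) = homology_class (r *: z).
Proof.
apply/homology_classE.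
have /homology_classE[y hy] := homology_classP (homology_class z).
by exists (r *: y); rewrite [RHS]linearZ /= -hy scalerBr.
Qed.

Lemma homology_scaleA (S : gradedRing) (a : int) (D : diffModule S a)
  (r s : S) (h : homology D) :
  homology_scale r (homology_scale s h) = homology_scale (r * s) h.
Proof. by rewrite -(homology_classP h) !homology_scaleE scalerA. Qed.
Lemma homology_scale1 (S : gradedRing) (a : int) (D : diffModule S a) :
  left_id 1 (@homology_scale S a D).
Proof. by move=> h; rewrite -(homology_classP h) homology_scaleE scale1r. Qed.
Lemma homology_scaleDr (S : gradedRing) (a : int) (D : diffModule S a) :
  right_distributive (@homology_scale S a D) +%R.
Proof.
move=> r h k; rewrite -(homology_classP h) -(homology_classP k).
by rewrite -homology_classD !homology_scaleE scalerDr homology_classD.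
Qed.
Lemma homology_scaleDl (S : gradedRing) (a : int) (D : diffModule S a)
  (h : homology D) : {morph (@homology_scale S a D)^~ h : r s / r + s}.
Proof.
move=> r s; rewrite -(homology_classP h) !homology_scaleE scalerDl.
exact: homology_classD.
Qed.

HB.instance Definition _ (S : gradedRing) (a : int) (D : diffModule S a) :=
  GRing.Zmodule_isLmodule.Build S (homology D) (@homology_scaleA S a D)
    (@homology_scale1 S a D) (@homology_scaleDr S a D)
    (@homology_scaleDl S a D).

Definition homology_comp (S : gradedRing) (a : int) (D : diffModule S a)
    (n : int) : set (homology D) := fun h =>
  exists z : cycles D, gmod_comp D n (cycle_val z) /\ h = homology_class z.

Lemma homology_class_sum (S : gradedRing) (a : int) (D : diffModule S a)
  (I : Type) (s : seq I) (z : I -> cycles D) :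
  homology_class (\sum_(i <- s) z i) = \sum_(i <- s) homology_class (z i).
Proof. exact: (raddf_sum (\pi_(Quotient.quot (boundary_pred D))%qT)). Qed.

Lemma cycle_val_sum (S : gradedRing) (a : int) (D : diffModule S a)
  (I : Type) (s : seq I) (z : I -> cycles D) :
  cycle_val (\sum_(i <- s) z i) = \sum_(i <- s) cycle_val (z i).
Proof. by elim: s => [|j s IH]; rewrite ?big_nil // !big_cons -IH. Qed.

Lemma is_grading_homology (S : gradedRing) (a : int) (D : diffModule S a) :
  is_grading (@homology_comp S a D).
Proof.
have gD := gmod_grading D; split.
- move=> n; exists 0; split; first exact: (grading0 gD).
  by rewrite homology_class0.
- move=> n _ _ [z [hz ->]] [w [hw ->]]; exists (z - w); split.
    exact: (gradingB gD).
  exact/esym/(raddfB (\pi_(Quotient.quot (boundary_pred D))%qT)).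
- move=> h; rewrite -(homology_classP h); move: (repr h) => z {h}.
  have [s [c [us cc zE]]] := grading_span gD (cycle_val z).
  have dz : dmod_d D (cycle_val z) = 0 by apply/eqP; case: (z).
  have dc n : n \in s -> dmod_d D (c n) = 0.
    apply: (grading_indep (is_grading_shift a gD) us (c := fun n => _ (c n))).
      by move=> m; apply: dmod_deg (cc m).
    by rewrite -linear_sum -zE.
  have dc' n : (if n \in s then c n else 0) \in cycle_pred D.
    by rewrite unfold_in; case: ifP => [/dc->|_]; rewrite ?linear0.
  exists s, (fun n => homology_class (Cycle (dc' n))); split=> //.
    move=> n; exists (Cycle (dc' n)); split=> //=.
    by case: ifP => // _; apply: (grading0 gD).
  rewrite -homology_class_sum; congr homology_class; apply: val_inj.
  rewrite /= cycle_val_sum zE; apply: eq_big_seq => n /= ns.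
  by rewrite ns.
- move=> s c us cc sc n ns.
  have /choice[z zP] m : exists z : cycles D,
    gmod_comp D m (cycle_val z) /\ c m = homology_class z by apply: cc.
  have /homology_classE[y hy] :
      homology_class (\sum_(m <- s) z m) = homology_class 0.
    rewrite homology_class_sum homology_class0 -[RHS]sc.
    by apply: eq_bigr => m _; case: (zP m).
  rewrite subr0 cycle_val_sum in hy.
  have [t [e [ut ec yE]]] := grading_span (is_grading_shift (- a) gD) y.
  pose e' m := if m \in t then e m else 0.
  pose z' m := if m \in s then cycle_val (z m) else 0.
  pose u := undup (s ++ t).
  have uu : uniq u by apply: undup_uniq.
  have E : \sum_(m <- u) (z' m - dmod_d D (e' m)) = 0.
    rewrite sumrB -linear_sum /=.
    rewrite (@big_extend D _ s u z' us uu); first last.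
    - by move=> i; rewrite /z' => /negbTE ->.
    - by move=> i si; rewrite mem_undup mem_cat si.
    rewrite (@big_extend D _ t u e' ut uu); first last.
    - by move=> i; rewrite /e' => /negbTE ->.
    - by move=> i si; rewrite mem_undup mem_cat si orbT.
    have -> : \sum_(m <- s) z' m = \sum_(m <- s) cycle_val (z m).
      by apply: eq_big_seq => m ms; rewrite /z' ms.
    have -> : \sum_(m <- t) e' m = y.
      by rewrite yE; apply: eq_big_seq => m ms; rewrite /e' ms.
    by rewrite hy subrr.
  have [_ ->] := zP n.
  rewrite -(homology_class0 D).
  apply/homology_classE; exists (e' n); rewrite subr0.
  have nu : n \in u by rewrite mem_undup mem_cat ns.
  have {}E := grading_indep gD uu _ E nu.
  apply/eqP; rewrite -subr_eq0; have := E _; rewrite /z' ns => -> // m.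
  apply: (gradingB gD).
    by rewrite /z'; case: ifP => _; [case: (zP m) | apply: (grading0 gD)].
  rewrite /e'; case: ifP => _; last by rewrite linear0; apply: (grading0 gD).
  by have := dmod_deg (ec m); rewrite /= subrK.
Qed.

Definition ghomology (S : gradedRing) (a : int) (D : diffModule S a) :
  gradedModule S.
Proof.
refine (@GradedModule S (homology D) (@homology_comp S a D)
          (is_grading_homology D) _).
move=> i n r _ Sr [z [hz ->]]; exists (r *: z); split.
  exact: gmod_compZ.
exact: homology_scaleE.
Defined.

Record dmod_mor (S : gradedRing) (a : int) (D E : diffModule S a) := DmodMor {
  dmor_fun :> {linear D -> E};
  dmor_deg : graded_map dmor_fun;
  dmor_comm : forall x, dmor_fun (dmod_d D x) = dmod_d E (dmor_fun x) }.

Lemma dmor_cycle_subproof (S : gradedRing) (a : int) (D E : diffModule S a)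
  (f : dmod_mor D E) (z : cycles D) : f (cycle_val z) \in cycle_pred E.
Proof.
case: z => z /= /eqP dz.
by apply/eqP; rewrite -dmor_comm dz linear0.
Qed.

Definition cycles_map (S : gradedRing) (a : int) (D E : diffModule S a)
  (f : dmod_mor D E) (z : cycles D) : cycles E :=
  Cycle (dmor_cycle_subproof f z).

Definition homology_map (S : gradedRing) (a : int) (D E : diffModule S a)
  (f : dmod_mor D E) (h : homology D) : homology E :=
  homology_class (cycles_map f (repr h)).

Lemma homology_mapE (S : gradedRing) (a : int) (D E : diffModule S a)
  (f : dmod_mor D E) (z : cycles D) :
  homology_map f (homology_class z) = homology_class (cycles_map f z).
Proof.
apply/homology_classE.
have /homology_classE[y hy] := homology_classP (homology_class z).
by exists (f y); rewrite -dmor_comm -hy linearB.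
Qed.

(* homology_map is linear of degree 0, so bijectivity makes it an isomorphism
   of graded modules. *)
Definition quasi_iso (S : gradedRing) (a : int) (D E : diffModule S a)
  (f : dmod_mor D E) := bijective (homology_map f).

(* Connected by a finite zigzag of quasi-isomorphisms. *)
Definition quasi_isomorphic (S : gradedRing) (a : int) :
    diffModule S a -> diffModule S a -> Prop :=
  clos_refl_sym_trans _ (fun D E => exists f : dmod_mor D E, quasi_iso f).

(* Homogeneous complexes ... -> C_1 -> C_0 -> 0 in nonnegative homological
   degrees. *)
Record gradedComplex (S : gradedRing) := GradedComplex {
  cplx_obj :> nat -> gradedModule S;
  cplx_d : forall i, {linear cplx_obj i.+1 -> cplx_obj i};
  cplx_deg : forall i, graded_map (cplx_d i);
  cplx_dd : forall i x, cplx_d i (cplx_d i.+1 x) = 0 }.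

Arguments cplx_d {S} C i : rename.

(* The direct sum of the C_i(ia) *)
Definition fold_mod (S : gradedRing) (a : int) (C : gradedComplex S) :
  gradedModule S := gdsum (fun i => gmod_shift (i%:Z * a) (C i)).

Definition fold_d (S : gradedRing) (a : int) (C : gradedComplex S)
  (x : fold_mod a C) : fold_mod a C.
Proof.
exists (fun i => cplx_d C i (dsum_fun x i.+1)).
case: (dsum_fin x) => n h; exists n => i ni.
by rewrite h ?linear0 // leqW.
Defined.

Lemma fold_d_linear (S : gradedRing) (a : int) (C : gradedComplex S) :
  linear (@fold_d S a C).
Proof. by move=> r x y; apply: dsumP => i /=; rewrite linearP. Qed.

HB.instance Definition _ (S : gradedRing) (a : int) (C : gradedComplex S) :=
  GRing.isLinear.Build S (fold_mod a C) (fold_mod a C) _ (@fold_d S a C)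
    (@fold_d_linear S a C).

Definition fold (S : gradedRing) (a : int) (C : gradedComplex S) :
  diffModule S a.
Proof.
refine (@DiffModule S a (fold_mod a C) (@fold_d S a C : {linear _ -> _}) _ _).
- move=> n x hx i /=; have := cplx_deg (hx i.+1).
  have -> // : n + i.+1%:Z * a = n + a + i%:Z * a.
  by rewrite -addn1 PoszD mulrDl mul1r addrA addrAC.
- by move=> x; apply: dsumP => i /=; rewrite cplx_dd.
Defined.

(* The complex F, augmented by eps : F_0 -> M, is a minimal free resolution of
   M by graded free modules of finite rank; F may be infinitely long.
   Minimality is im d contained in m F, for m the homogeneous maximal ideal. *)
Record is_min_resolution (S : gradedLocalRing) (M : gradedModule S)
    (F : gradedComplex S) (eps : {linear F 0%N -> M}) : Prop := {
  mres_free : forall i, graded_fin_free (F i);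
  mres_aug : graded_map eps;
  mres_surj : forall y, exists x, eps x = y;
  mres_exact0 : forall x, eps x = 0 <-> exists y, x = cplx_d F 0 y;
  mres_exact : forall i x,
    cplx_d F i x = 0 <-> exists y, x = cplx_d F i.+1 y;
  mres_min : forall i x, exists (n : nat) (r : nat -> S) (y : nat -> F i),
    (forall j, glr_max (r j)) /\ cplx_d F i x = \sum_(j < n) r j *: y j }.

Definition min_free_resolution (S : gradedLocalRing) (M : gradedModule S)
    (F : gradedComplex S) :=
  exists eps : {linear F 0%N -> M}, is_min_resolution eps.

(* Main.v *)
Require Import Defs.
From HB Require Import structures.
From Stdlib Require Import Relations.
From mathcomp Require Import all_boot all_order all_algebra.
From mathcomp Require Import boolp classical_sets.
From mathcomp Require Import zify.

Set Implicit Arguments.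
Unset Strict Implicit.
Unset Printing Implicit Defensive.

Import Order.TTheory GRing.Theory Num.Theory.
Local Open Scope ring_scope.

(** The augmentation of F lifts to a map from F_0 to the cycles of D, and one
    extends it degree by degree to maps f_i from F_i to D with
    d f_(i+1) = f_i d; their sum is a morphism Fold^a(F) -> D, and it is a
    quasi-isomorphism as soon as it exists.  The obstruction to f_(i+1), i >= 1,
    is a degree 0 map from F_(i+1) to H(D)(-ia) = M(-ia).  As M has finite
    length it lives in bounded degrees, so the obstruction vanishes for
    |a| large, uniformly in i, provided that the degrees of the generators of
    F_i lie between a constant and a linear function of i.

    For the linear upper bound let K be the Koszul complex on homogeneous
    generators x_1, ..., x_r of the irrelevant ideal.  Its homology is finitely
    generated and killed by the x_l, hence vanishes in degrees > q for some q.
    If a basis element e of F_i had degree too large with respect to the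
    generators of F_0, ..., F_(i-1), a diagram chase in the double complex
    F (x) K, of length r in the direction of K, would write e as an element of
    d F_(i+1) + (x_1, ..., x_r) F_i, against minimality. *)

(** * Homogeneous components *)

Section HomogeneousComponents.
Context (I : eqType) (V : zmodType) (comp : I -> set V).
Hypothesis gV : is_grading comp.

Lemma gradingN i x : comp i x -> comp i (- x).
Proof.
by move=> cx; rewrite -sub0r; apply: (gradingB gV) => //; apply: grading0.
Qed.

Lemma gradingD i x y : comp i x -> comp i y -> comp i (x + y).
Proof.
by move=> cx cy; rewrite -[y]opprK; apply: (gradingB gV) => //; apply: gradingN.
Qed.

Lemma grading_sum i (J : Type) (s : seq J) (P : pred J) (c : J -> V) :
  (forall j, P j -> comp i (c j)) -> comp i (\sum_(j <- s | P j) c j).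
Proof.
by move=> h; elim/big_ind: _ => //; [exact: grading0 | move=> *; exact: gradingD].
Qed.

Lemma hcomp_subproof x : exists sc : seq I * (I -> V),
  [/\ uniq sc.1, forall i, comp i (sc.2 i) & x = \sum_(i <- sc.1) sc.2 i].
Proof. by have [s [c h]] := grading_span gV x; exists (s, c). Qed.

(** The decomposition is picked by choice, and its family is arbitrary off the support, where the
    value is therefore set to 0. *)
Definition hcomp i x : V :=
  let sc := projT1 (cid (hcomp_subproof x)) in
  if i \in sc.1 then sc.2 i else 0.

(** Two decompositions of one element, extended by 0 to the union of their supports, differ by a
    family with zero sum, which vanishes termwise by independence. So [hcomp] does not depend on the
    choice made. *)
Lemma hcompE (s : seq I) (c : I -> V) : uniq s -> (forall i, comp i (c i)) ->
  forall i, hcomp i (\sum_(j <- s) c j) = if i \in s then c i else 0.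
Proof.
move=> us cc i; rewrite /hcomp; case: cid => -[t e] /= [ut ec E].
pose c' j := if j \in s then c j else 0.
pose e' j := if j \in t then e j else 0.
pose u := undup (s ++ t).
have uu : uniq u by apply: undup_uniq.
have E1 : \sum_(j <- u) (e' j - c' j) = 0.
  rewrite sumrB.
  rewrite (@big_extend V _ s u c' us uu); first last.
  - by move=> j; rewrite /c' => /negbTE ->.
  - by move=> j sj; rewrite mem_undup mem_cat sj.
  rewrite (@big_extend V _ t u e' ut uu); first last.
  - by move=> j; rewrite /e' => /negbTE ->.
  - by move=> j sj; rewrite mem_undup mem_cat sj orbT.
  have -> : \sum_(j <- s) c' j = \sum_(j <- s) c j.
    by apply: eq_big_seq => j js; rewrite /c' js.
  have -> : \sum_(j <- t) e' j = \sum_(j <- t) e j.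
    by apply: eq_big_seq => j js; rewrite /e' js.
  by rewrite -E subrr.
have {}E1 : i \in u -> e' i - c' i = 0.
  apply: (grading_indep gV uu (c := fun j => e' j - c' j)) => // j.
  apply: (gradingB gV); first by rewrite /e'; case: ifP => _ //; apply: grading0.
  by rewrite /c'; case: ifP => _ //; apply: grading0.
have [iu|] := boolP (i \in u); first by apply/eqP; rewrite -subr_eq0; apply/eqP/E1.
by rewrite mem_undup mem_cat negb_or => /andP[/negbTE -> /negbTE ->].
Qed.

Lemma hcompP i x : comp i (hcomp i x).
Proof.
rewrite /hcomp; case: cid => -[t e] /= [ut ec E].
by case: ifP => _ //; apply: grading0.
Qed.

Lemma hcomp_sum x : exists2 s, uniq s &
  (forall i, i \notin s -> hcomp i x = 0) /\ x = \sum_(i <- s) hcomp i x.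
Proof.
have [s [c [us cc ->]]] := grading_span gV x.
exists s => //; split=> [i /negbTE si|]; first by rewrite hcompE // si.
by apply: eq_big_seq => i si; rewrite hcompE // si.
Qed.

Lemma hcomp_id i x : comp i x -> forall j, hcomp j x = if j == i then x else 0.
Proof.
move=> cx j; have cc k : comp k (if k == i then x else 0).
  by case: eqP => [->|_] //; apply: grading0.
have := hcompE (s := [:: i]) isT cc j.
rewrite big_seq1 eqxx inE => E; rewrite [LHS]E.
by case: (j == i).
Qed.

Lemma hcomp_zmod i : zmod_morphism (hcomp i).
Proof.
move=> x y.
have [s us [s0 sE]] := hcomp_sum x; have [t ut [t0 tE]] := hcomp_sum y.
pose u := undup (s ++ t).
have uu : uniq u by apply: undup_uniq.
have xE : x = \sum_(i <- u) hcomp i x.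
  rewrite (big_extend us uu) // => j sj.
  by rewrite mem_undup mem_cat sj.
have yE : y = \sum_(i <- u) hcomp i y.
  rewrite (big_extend ut uu) // => j sj.
  by rewrite mem_undup mem_cat sj orbT.
have -> : hcomp i (x - y) = hcomp i (\sum_(i <- u) (hcomp i x - hcomp i y)).
  by rewrite sumrB -xE -yE.
rewrite hcompE //; last by move=> j; apply: (gradingB gV); apply: hcompP.
case: ifPn => //; rewrite mem_undup mem_cat negb_or => /andP[/s0 -> /t0 ->].
by rewrite subr0.
Qed.

HB.instance Definition _ i := GRing.isZmodMorphism.Build V V (hcomp i) (hcomp_zmod i).

End HomogeneousComponents.

(** [q] is the effect of [f] on degrees; its injectivity keeps distinct components from meeting in
    one degree of [W]. *)
Lemma hcomp_map (I J : eqType) (V W : zmodType) (cV : I -> set V)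
    (cW : J -> set W) (gV : is_grading cV) (gW : is_grading cW) (q : I -> J)
    (f : {additive V -> W}) : injective q ->
  (forall i x, cV i x -> cW (q i) (f x)) ->
  forall i x, hcomp gW (q i) (f x) = f (hcomp gV i x).
Proof.
move=> qI fq i x; have [s us [s0 sE]] := hcomp_sum gV x.
rewrite {1}sE !raddf_sum /=.
under eq_bigr => j _ do rewrite (hcomp_id _ (fq _ _ (hcompP gV j x))).
have [si|si] := boolP (i \in s).
  rewrite (bigD1_seq i) //= eqxx big1 ?addr0 // => j ji.
  by rewrite (inj_eq qI) eq_sym (negbTE ji).
rewrite s0 // raddf0 big1_seq // => j /andP[_ js].
by rewrite (inj_eq qI); case: eqP => // e; rewrite e js in si.
Qed.

(** As [f] commutes with taking components, the component of [x] in degree [i] is such a preimage.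
    Preimages obtained from exactness are made homogeneous in this way. *)
Lemma hcomp_pre (I : eqType) (V W : zmodType) (cV : I -> set V)
    (cW : I -> set W) (gV : is_grading cV) (gW : is_grading cW)
    (f : {additive V -> W}) :
  (forall i x, cV i x -> cW i (f x)) ->
  forall i x, cW i (f x) -> exists2 y, cV i y & f y = f x.
Proof.
move=> ff i x fx; exists (hcomp gV i x); first exact: hcompP.
by rewrite -(@hcomp_map _ _ _ _ _ _ gV gW id f) // (hcomp_id _ fx) eqxx.
Qed.

(** * Coordinates with respect to a basis of a free module *)

Section BasisCoordinates.
Context (R : nzRingType) (V : lmodType R) (n : nat) (e : 'I_n -> V).
Hypothesis he : is_basis e.

Definition bcoord (j : 'I_n) (x : V) : R^o := projT1 (cid (he x)) j.

Lemma bcoord_sum x : x = \sum_j bcoord j x *: e j.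
Proof. by rewrite /bcoord; case: cid => c []. Qed.

Lemma bcoordE (c : 'I_n -> R) x : x = \sum_j c j *: e j ->
  forall j, bcoord j x = c j.
Proof.
move=> E j; rewrite /bcoord; case: cid => d /= [_ /(_ (finfun c)) ->].
  by rewrite ffunE.
by rewrite E; apply: eq_bigr => k _; rewrite ffunE.
Qed.

Lemma bcoord_linear j : linear (bcoord j).
Proof.
move=> r x y; apply: (@bcoordE (fun k => r * bcoord k x + bcoord k y)).
rewrite {1}(bcoord_sum x) {1}(bcoord_sum y) scaler_sumr -big_split /=.
by apply: eq_bigr => k _; rewrite scalerDl scalerA.
Qed.

HB.instance Definition _ j :=
  GRing.isLinear.Build R V R^o _ (bcoord j) (bcoord_linear j).

Lemma bcoord_basis j k : bcoord j (e k) = (j == k)%:R.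
Proof.
apply: (@bcoordE (fun j => (j == k)%:R)).
rewrite (bigD1 k) //= eqxx scale1r big1 ?addr0 // => i /negbTE ->.
by rewrite scale0r.
Qed.

(** The linear map with value [y j] on [e j]. *)
Definition blin (W : lmodType R) (y : 'I_n -> W) (x : V) : W :=
  \sum_j bcoord j x *: y j.

Lemma blin_linear (W : lmodType R) (y : 'I_n -> W) : linear (blin y).
Proof.
move=> r u v; rewrite /blin scaler_sumr -big_split /=.
by apply: eq_bigr => k _; rewrite linearP scalerDl scalerA.
Qed.

HB.instance Definition _ (W : lmodType R) (y : 'I_n -> W) :=
  GRing.isLinear.Build R V W _ (blin y) (blin_linear y).

End BasisCoordinates.

(** Extension by 0 to negative degrees lets S serve as a graded module over itself. *)
Lemma is_grading_int (V : zmodType) (comp : nat -> set V) : is_grading comp ->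
  is_grading (fun (n : int) x => if n is Posz m then comp m x else x = 0).
Proof.
move=> gV; split.
- by case=> // m; apply: grading0.
- by case=> [m|m] x y; [apply: (gradingB gV) | move=> -> ->; rewrite subr0].
- move=> x; have [s [c [us cc ->]]] := grading_span gV x.
  exists [seq Posz m | m <- s], (fun n => if n is Posz m then c m else 0).
  by split; [rewrite map_inj_uniq // => a b [] | case | rewrite big_map].
- move=> s c us cc sc n ns.
  pose t := [seq absz m | m : int <- s & 0 <= m].
  have ut : uniq t.
    rewrite map_inj_in_uniq ?filter_uniq // => a b.
    by rewrite !mem_filter => /andP[a0 _] /andP[b0 _]; lia.
  have E : \sum_(m <- t) c (Posz m) = 0.
    rewrite big_map big_filter -[RHS]sc [RHS](bigID (>= 0)) /= [X in _ + X]big1.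
      by rewrite addr0; apply: eq_bigr => -[].
    by move=> [] // m _; apply: (cc (Negz m)).
  case: n ns => [m|m] ns; last exact: (cc (Negz m)).
  apply: (grading_indep gV ut (c := fun m => c (Posz m))) => //.
    by move=> k; apply: (cc (Posz k)).
  by apply/mapP; exists (Posz m) => //; rewrite mem_filter.
Qed.

Definition gmod_reg (S : gradedRing) : gradedModule S.
Proof.
refine (@GradedModule S S^o _ (is_grading_int (gring_grading S)) _).
move=> i [m|m] r x Sr; first exact: gring_compM.
move=> ->; rewrite scaler0.
exact: (grading0 (is_grading_int (gring_grading S))).
Defined.

Lemma is_grading_prod (I : eqType) (V W : zmodType) (cV : I -> set V)
    (cW : I -> set W) : is_grading cV -> is_grading cW ->
  is_grading (fun n (x : V * W) => cV n x.1 /\ cW n x.2).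
Proof.
move=> gV gW; split.
- by move=> n; split; apply: grading0.
- move=> n x y [x1 x2] [y1 y2].
  by split; [apply: (gradingB gV) | apply: (gradingB gW)].
- move=> [x y]; have [s us [s0 sE]] := hcomp_sum gV x.
  have [t ut [t0 tE]] := hcomp_sum gW y.
  exists (undup (s ++ t)), (fun i => (hcomp gV i x, hcomp gW i y)).
  split=> [|i|]; first exact: undup_uniq.
    by split; apply: hcompP.
  have E : \sum_(i <- undup (s ++ t)) (hcomp gV i x, hcomp gW i y) =
     (\sum_(i <- undup (s ++ t)) hcomp gV i x, \sum_(i <- undup (s ++ t)) hcomp gW i y).
    by elim: (undup _) => [|i u IH]; rewrite ?big_nil // !big_cons IH.
  rewrite E; congr pair.
    rewrite {1}sE; apply/esym/big_extend; rewrite ?undup_uniq // => j sj.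
    by rewrite mem_undup mem_cat sj.
  rewrite {1}tE; apply/esym/big_extend; rewrite ?undup_uniq // => j sj.
  by rewrite mem_undup mem_cat sj orbT.
- move=> s c us cc sc n ns.
  have E1 : \sum_(i <- s) (c i).1 = 0 by rewrite -(raddf_sum fst) sc.
  have E2 : \sum_(i <- s) (c i).2 = 0 by rewrite -(raddf_sum snd) sc.
  rewrite [c n]surjective_pairing.
  rewrite (grading_indep gV us _ E1) //; last by move=> i; case: (cc i).
  by rewrite (grading_indep gW us _ E2) //; move=> i; case: (cc i).
Qed.

Definition gmod_prod (S : gradedRing) (V W : gradedModule S) : gradedModule S.
Proof.
refine (@GradedModule S (V * W)%type _
  (is_grading_prod (gmod_grading V) (gmod_grading W)) _).
by move=> i n r x Sr [x1 x2]; split; apply: gmod_compZ.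
Defined.

(** Taking components in the expansion of [x] gives a second expansion of [x], so uniqueness makes
    the coordinates homogeneous. For [m < b j] the coordinate is thus 0. *)
Lemma bcoord_graded (S : gradedRing) (V : gradedModule S) n (e : 'I_n -> V)
    (he : is_basis e) (b : 'I_n -> int) :
  (forall j, gmod_comp V (b j) (e j)) ->
  forall m x, gmod_comp V m x ->
  forall j, gmod_comp (gmod_reg S) (m - b j) (bcoord he j x : S^o).
Proof.
move=> eb m x xm.
have gS := gmod_grading (gmod_reg S).
suff E j : bcoord he j x = hcomp gS (m - b j) (bcoord he j x : S^o).
  by move=> j; rewrite E; apply: hcompP.
apply: (bcoordE he (c := fun j => hcomp gS (m - b j) (bcoord he j x : S^o))).
have {1}-> : x = hcomp (gmod_grading V) m x.
  by rewrite (hcomp_id _ xm) eqxx.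
rewrite {1}(bcoord_sum he x) raddf_sum; apply: eq_bigr => k _.
pose f := GRing.scale^~ (e k) : S^o -> V.
have fz : zmod_morphism f by move=> u v; rewrite /f scalerBl.
pose fa : {additive S^o -> V} := HB.pack f (GRing.isZmodMorphism.Build S^o V f fz).
have := @hcomp_map _ _ _ _ _ _ gS (gmod_grading V) (fun n => n + b k) fa
  (@addIr _ _) _ (m - b k).
rewrite subrK; apply => -[i|i] r; last first.
  by move=> ->; rewrite raddf0; apply: (grading0 (gmod_grading V)).
by move=> Sr; apply: gmod_compZ.
Qed.

(** * Koszul complexes *)

Section Koszul.
Context (S : gradedRing) (x : nat -> S) (dg : nat -> nat).
Hypothesis xdg : forall l, gring_comp (dg l) (x l).

(* The Koszul complex on x 0, ..., x (r - 1) with coefficients in V, built as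
   an iterated mapping cone; all homological degrees are summed. *)
Fixpoint Kos (r : nat) (V : gradedModule S) : gradedModule S :=
  if r is r'.+1 then
    gmod_prod (Kos r' V) (gmod_shift (- (dg r')%:Z) (Kos r' V))
  else V.

(** The cone of multiplication by [x r']: the second summand is shifted by one homological degree,
    whence the sign, and internally by [dg r'], which makes the differential of degree 0. *)
Fixpoint Kd (r : nat) (V : gradedModule S) : Kos r V -> Kos r V :=
  if r is r'.+1 then
    fun u => (Kd u.1 + x r' *: u.2, - Kd u.2)
  else fun _ => 0.

Lemma Kd_linear r V : linear (@Kd r V).
Proof.
elim: r => [|r IH] a u v /=; first by rewrite scaler0 addr0.
congr pair => /=; last by rewrite IH opprD scalerN.
by rewrite IH !scalerDr !scalerA mulrC addrACA.
Qed.
HB.instance Definition _ r V :=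
  GRing.isLinear.Build S (Kos r V) (Kos r V) _ (@Kd r V) (@Kd_linear r V).

Lemma Kd_Kd r V (u : Kos r V) : Kd (Kd u) = 0.
Proof.
elim: r u => [|r IH] //= u.
congr pair => /=; last by rewrite linearN /= IH oppr0 oppr0.
by rewrite linearD linearZ /= IH add0r scalerN subrr.
Qed.

Lemma Kd_graded r V : graded_map (@Kd r V).
Proof.
elim: r => [|r IH] n u /=; first by move=> _; apply: (grading0 (gmod_grading V)).
case=> u1 u2; have gK := gmod_grading (Kos r V); split.
  apply: (gradingD gK); first exact: IH.
  have := gmod_compZ (xdg r) u2; by rewrite addrC subrK.
by apply: (gradingN gK); apply: IH.
Qed.

Fixpoint Kmap (r : nat) (V W : gradedModule S) (f : V -> W) :
    Kos r V -> Kos r W :=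
  if r is r'.+1 then fun u => (Kmap f u.1, Kmap f u.2) else f.

Lemma Kmap_linear r (V W : gradedModule S) (f : {linear V -> W}) :
  linear (@Kmap r V W f).
Proof.
elim: r => [|r IH] a u v /=; first by rewrite linearP.
by rewrite !IH.
Qed.
HB.instance Definition _ r (V W : gradedModule S) (f : {linear V -> W}) :=
  GRing.isLinear.Build S (Kos r V) (Kos r W) _ (@Kmap r V W f)
    (@Kmap_linear r V W f).

Lemma Kmap_graded r (V W : gradedModule S) (f : V -> W) (a : int) :
  (forall n v, gmod_comp V n v -> gmod_comp W (n + a) (f v)) ->
  forall n u, gmod_comp (Kos r V) n u -> gmod_comp (Kos r W) (n + a) (Kmap f u).
Proof.
move=> fa; elim: r => [|r IH] n u /=; first exact: fa.
by case=> /IH h1 /IH h2; split=> //; rewrite addrAC.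
Qed.

Lemma Kmap_Kd r (V W : gradedModule S) (f : {linear V -> W}) (u : Kos r V) :
  Kmap f (Kd u) = Kd (Kmap f u).
Proof.
elim: r u => [|r IH] u /=; first by rewrite linear0.
by rewrite linearD linearN linearZ /= !IH.
Qed.

Lemma Kmap_comp0 r (U V W : gradedModule S) (g : U -> V) (f : V -> W) :
  (forall v, f (g v) = 0) -> forall u : Kos r U, Kmap f (Kmap g u) = 0.
Proof. by move=> fg; elim: r => [|r IH] u //=; rewrite !IH. Qed.

(** As a module, [Kos r V] is a finite sum of copies of [V], on each of which [Kmap f] acts as
    [f]. *)
Lemma Kmap_exact r (U V W : gradedModule S) (g : U -> V) (f : V -> W) :
  (forall v, f v = 0 -> exists u, v = g u) ->
  forall v : Kos r V, Kmap f v = 0 -> exists u, v = Kmap g u.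
Proof.
move=> fg; elim: r => [|r IH] //= [v1 v2] /= [/IH[u1 ->] /IH[u2 ->]].
by exists (u1, u2).
Qed.

(** Applied to the coordinates and the multiples of the vectors of a basis of [V], this splits the
    Koszul complex of [V] into copies of that of S. *)
Lemma Kmap_decomp r (V W : gradedModule S) n
    (f : 'I_n -> {linear V -> W}) (g : 'I_n -> {linear W -> V}) :
  (forall v, v = \sum_j g j (f j v)) ->
  forall u : Kos r V, u = \sum_j Kmap (g j) (Kmap (f j) u).
Proof.
move=> fg; elim: r => [|r IH] //= [u1 u2] /=.
rewrite [RHS]surjective_pairing (raddf_sum fst) (raddf_sum snd) /=.
by rewrite -IH -IH.
Qed.

(* projection to homological degree t *)
Fixpoint Kpi (r t : nat) (V : gradedModule S) : Kos r V -> Kos r V :=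
  if r is r'.+1 then
    fun u => (Kpi t u.1, if t is t'.+1 then Kpi t' u.2 else 0)
  else fun u => if t is 0 then u else 0.

Lemma Kpi_linear r t V : linear (@Kpi r t V).
Proof.
elim: r t => [|r IH] [|t] a u v //=; rewrite ?IH //.
  by rewrite scaler0 addr0.
by congr pair; rewrite /= scaler0 addr0.
Qed.
HB.instance Definition _ r t V :=
  GRing.isLinear.Build S (Kos r V) (Kos r V) _ (@Kpi r t V) (@Kpi_linear r t V).

Lemma Kpi_graded r t V : graded_map (@Kpi r t V).
Proof.
elim: r t => [|r IH] [|t] n u //=.
- by move=> _; apply: (grading0 (gmod_grading V)).
- by case=> u1 u2; split; [apply: IH | apply: (grading0 (gmod_grading (Kos r V)))].
- by case=> u1 u2; split; apply: IH.
Qed.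

Lemma Kpi_idem r t V (u : Kos r V) : Kpi t (Kpi t u) = Kpi t u.
Proof. by elim: r t u => [|r IH] [|t] u //=; rewrite !IH. Qed.

Lemma Kd_Kpi0 r V (u : Kos r V) : Kd (Kpi 0 u) = 0.
Proof. by elim: r u => [|r IH] u //=; rewrite IH scaler0 linear0 addr0 oppr0. Qed.

Lemma Kpi_Kd r t V (u : Kos r V) : Kpi t (Kd u) = Kd (Kpi t.+1 u).
Proof.
elim: r t u => [|r IH] [|t] u //=; congr pair.
- by rewrite /= linearD linearZ /= IH.
- by rewrite /= Kd_Kpi0 oppr0.
- by rewrite /= linearD linearZ /= IH.
- by rewrite /= linearN /= IH.
Qed.

Lemma Kpi_Kmap r t (V W : gradedModule S) (f : {linear V -> W}) (u : Kos r V) :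
  Kpi t (Kmap f u) = Kmap f (Kpi t u).
Proof.
by elim: r t u => [|r IH] [|t] u //=; rewrite ?linear0 ?IH.
Qed.

Lemma Kpi_large r t V (u : Kos r V) : (r < t)%N -> Kpi t u = 0.
Proof.
elim: r t u => [|r IH] [|t] u //= rt.
by rewrite !IH // ltnW.
Qed.

(** [Kin] and [Kout] are the inclusion of, and the projection to, the copy of [V] in homological
    degree 0. *)
Fixpoint Kin (r : nat) (V : gradedModule S) (v : V) : Kos r V :=
  if r is r'.+1 then (Kin r' v, 0) else v.

Fixpoint Kout (r : nat) (V : gradedModule S) : Kos r V -> V :=
  if r is r'.+1 then fun u => Kout u.1 else id.

Lemma Kin_graded r V : graded_map (@Kin r V).
Proof.
elim: r => [|r IH] n v //= vn; split; first exact: IH.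
exact: (grading0 (gmod_grading (Kos r V))).
Qed.

Lemma Kd_Kin r (V : gradedModule S) (v : V) : Kd (Kin r v) = 0.
Proof. by elim: r => [|r IH] //=; rewrite IH scaler0 linear0 oppr0 addr0. Qed.

Lemma Kpi_Kin r (V : gradedModule S) (v : V) : Kpi 0 (Kin r v) = Kin r v.
Proof. by elim: r => [|r IH] //=; rewrite IH. Qed.

Lemma Kout_Kin r (V : gradedModule S) (v : V) : Kout (Kin r v) = v.
Proof. by elim: r. Qed.

Lemma KoutD r V (u v : Kos r V) : Kout (u + v) = Kout u + Kout v.
Proof. by elim: r u v => [|r IH] u v //=; rewrite IH. Qed.

Lemma Kout_Kmap r (V W : gradedModule S) (f : V -> W) (u : Kos r V) :
  Kout (Kmap f u) = f (Kout u).
Proof. by elim: r u => [|r IH] u //=. Qed.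

Lemma KoutZ r V a (v : Kos r V) : Kout (a *: v) = a *: Kout v.
Proof. by elim: r v => [|r IH] v //=; rewrite IH. Qed.

(** The differential from homological degree 1 to degree 0 sends a family v_l to the sum of the x_l
    v_l. *)
Lemma Kout_Kd r V (u : Kos r V) :
  exists v : nat -> V, Kout (Kd u) = \sum_(l < r) x l *: v l.
Proof.
elim: r u => [|r IH] u /=; first by exists (fun _ => 0); rewrite big_ord0.
have [v E] := IH u.1.
exists (fun l => if l == r then Kout u.2 else v l).
rewrite KoutD KoutZ E big_ord_recr /= eqxx; congr (_ + _).
by apply: eq_bigr => i _; rewrite ltn_eqF.
Qed.

(** Up to sign, exterior multiplication by the [l]-th basis vector; it is a null-homotopy of
    multiplication by [x l]. *)
Fixpoint Kh (l r : nat) (V : gradedModule S) : Kos r V -> Kos r V :=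
  if r is r'.+1 then
    fun u => if l == r' then (0, u.1) else (Kh l u.1, - Kh l u.2)
  else fun _ => 0.

Lemma Kh_linear l r V : linear (@Kh l r V).
Proof.
elim: r => [|r IH] a u v /=; first by rewrite scaler0 addr0.
case: eqP => _; congr pair; rewrite /= ?IH ?scaler0 ?addr0 //.
by rewrite opprD scalerN.
Qed.
HB.instance Definition _ l r V :=
  GRing.isLinear.Build S (Kos r V) (Kos r V) _ (@Kh l r V) (@Kh_linear l r V).

Lemma Kh_homotopy l r V (u : Kos r V) : (l < r)%N ->
  Kd (Kh l u) + Kh l (Kd u) = x l *: u.
Proof.
elim: r u => [|r IH] //= [u1 u2] lr /=.
case: eqP => [->|/eqP ne]; rewrite /=.
  rewrite linear0 add0r; congr pair => /=; first by rewrite addr0.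
  by rewrite addrA addNr add0r.
have {}lr : (l < r)%N by rewrite ltn_neqAle ne.
congr pair => /=.
  by rewrite linearD linearZ /= scalerN addrACA IH // addNr addr0.
by rewrite !linearN /= !opprK IH.
Qed.

(** By the homotopy, [x l] annihilates Koszul homology. *)
Lemma Kd_scale_cycle l r V (u : Kos r V) : (l < r)%N -> Kd u = 0 ->
  x l *: u = Kd (Kh l u).
Proof. by move=> lr du; rewrite -Kh_homotopy // du linear0 addr0. Qed.

End Koszul.

(** * Finite generation and the irrelevant ideal *)

Section Span.
Context (S : comNzRingType) (x : nat -> S) (r : nat).

Definition in_span (y : S) := exists c : nat -> S, y = \sum_(l < r) c l * x l.

Lemma in_span0 : in_span 0.
Proof. by exists (fun _ => 0); rewrite big1 // => i _; rewrite mul0r. Qed.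

Lemma in_spanD y z : in_span y -> in_span z -> in_span (y + z).
Proof.
move=> [c ->] [d ->]; exists (fun l => c l + d l).
by rewrite -big_split; apply: eq_bigr => l _; rewrite mulrDl.
Qed.

Lemma in_spanM a y : in_span y -> in_span (a * y).
Proof.
move=> [c ->]; exists (fun l => a * c l).
by rewrite mulr_sumr; apply: eq_bigr => l _; rewrite mulrA.
Qed.

Lemma in_span_gen l : (l < r)%N -> in_span (x l).
Proof.
move=> lr; exists (fun k => (k == l)%:R).
rewrite (bigD1 (Ordinal lr)) //= eqxx mul1r big1 ?addr0 // => j.
by rewrite -val_eqE /= => /negbTE ->; rewrite mul0r.
Qed.

Lemma in_span_sum (I : Type) (s : seq I) (P : pred I) (f : I -> S) :
  (forall i, P i -> in_span (f i)) -> in_span (\sum_(i <- s | P i) f i).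
Proof.
by move=> h; elim/big_ind: _ => //; [exact: in_span0 | exact: in_spanD].
Qed.

End Span.

(** Generators are indexed by any finite type, so that a product of modules can use a disjoint union
    of index types. *)
Definition noetherian_mod (R : nzRingType) (V : lmodType R) :=
  forall W : set V, is_submodule W -> exists (I : finType) (g : I -> V),
    (forall i, W (g i)) /\
    forall x, W x -> exists c : I -> R, x = \sum_i c i *: g i.

Lemma noetherian_reg (R : comNzRingType) : noetherian R -> noetherian_mod R^o.
Proof.
move=> nR W [W0 WD WZ].
have [|s sP] := nR W; first by split=> // r x _; apply: WZ.
exists 'I_(size s), (fun i : 'I_(size s) => s`_i); split=> [i|x /sP[c ->]].
  by apply/sP; apply: (@in_span_gen R (nth 0 s)).
by exists (fun i : 'I_(size s) => c i).
Qed.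

(** Generators of the intersection of [U] with [V], together with lifts of generators of the
    projection of [U] to [W], generate [U]. *)
Lemma noetherian_prod (R : nzRingType) (V W : lmodType R) :
  noetherian_mod V -> noetherian_mod W -> noetherian_mod (V * W)%type.
Proof.
move=> nV nW U [U0 UD UZ].
have [|I [g [gU gP]]] := nV (fun v => U (v, 0)).
  split=> [|x y Ux Uy|r x Ux] //.
    by have := UD _ _ Ux Uy; rewrite /GRing.add /= /add_pair /= addr0.
  by have := UZ r _ Ux; rewrite /GRing.scale /= /scale_pair /= scaler0.
have [|J [h [hU hP]]] := nW (fun w => exists v, U (v, w)).
  split=> [|x y [v Ux] [w Uy]|r x [v Ux]]; first by exists 0.
    by exists (v + w); apply: (UD _ _ Ux Uy).
  by exists (r *: v); apply: (UZ r _ Ux).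
have [k kP] := choice hU.
exists (I + J)%type, (fun i => match i with inl i => (g i, 0)
                                       | inr j => (k j, h j) end).
split=> [[]//|[v w] Uvw].
have [d wE] : exists d : J -> R, w = \sum_j d j *: h j by apply: hP; exists v.
have UN x : U x -> U (- x) by move=> /(UZ (-1)); rewrite scaleN1r.
have Uv : U (v - \sum_j d j *: k j, 0).
  have -> : (v - \sum_j d j *: k j, 0) = (v, w) - \sum_j d j *: (k j, h j).
    apply/pair_equal_spec; split=> /=; first by rewrite (raddf_sum fst).
    by rewrite (raddf_sum snd) /= -wE subrr.
  apply: (UD) => //; apply: UN.
  by apply: (big_ind U) => // j _; apply: (UZ (d j) (k j, h j)); apply: kP.
have [c vE] := gP _ Uv.
exists (fun i => match i with inl i => c i | inr j => d j end).
rewrite big_sumType /=; apply/pair_equal_spec; split => /=.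
  by rewrite !(raddf_sum fst) /= -vE subrK.
rewrite !(raddf_sum snd) /= -wE big1 ?add0r // => i _.
by rewrite scaler0.
Qed.

Lemma noetherian_Kos (S : gradedRing) dg r (V : gradedModule S) :
  noetherian_mod V -> noetherian_mod (Kos dg r V).
Proof. by move=> nV; elim: r => [|r IH] //=; apply: noetherian_prod. Qed.

Definition generates_irrelevant (S : gradedRing) (x : nat -> S) (r : nat) :=
  forall m (y : S), (0 < m)%N -> gring_comp m y -> in_span x r y.

Section IrrelevantIdeal.
Context (S : gradedRing).
Let gS := gring_grading S.

(** Degrees are natural numbers, so i + j = 0 forces i = j = 0: only the two degree 0 parts
    contribute. *)
Lemma hcomp0M (r y : S) : hcomp gS 0 (r * y) = hcomp gS 0 r * hcomp gS 0 y.
Proof.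
have [s us [s0 sE]] := hcomp_sum gS y.
have E j z : gring_comp j z ->
    hcomp gS 0 (r * z) = if j == 0%N then hcomp gS 0 r * z else 0.
  move=> zj; have [t ut [t0 tE]] := hcomp_sum gS r.
  rewrite {1}tE mulr_suml raddf_sum /=.
  under eq_bigr => i _.
    rewrite (hcomp_id gS (gring_compM (hcompP gS i r) zj)).
  over.
  case: eqP => [->|/eqP j0].
    have [ti|ti] := boolP (0%N \in t).
      rewrite (bigD1_seq 0%N) //= big1 ?addr0 // => i i0.
      by rewrite addn0 eq_sym (negbTE i0).
    rewrite t0 // mul0r big1_seq // => i /andP[_ it].
    by rewrite addn0; case: eqP => // e; rewrite -e (negbTE ti) in it.
  by rewrite big1 // => i _; rewrite eq_sym addn_eq0 (negbTE j0) andbF.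
rewrite {1}sE mulr_sumr raddf_sum /=.
under eq_bigr => i _ do rewrite (E _ _ (hcompP gS i y)).
have [si|si] := boolP (0%N \in s).
  by rewrite (bigD1_seq 0%N) //= big1 ?addr0 // => i /negbTE ->.
rewrite s0 // mulr0 big1_seq // => i /andP[_ it].
by case: eqP => // e; rewrite e (negbTE si) in it.
Qed.

(** The irrelevant ideal is the kernel of the projection to S_0. The homogeneous components of
    positive degree of finitely many generators generate it as well. *)
Lemma irrelevant_generators : noetherian S ->
  exists (r : nat) (x : nat -> S) (dg : nat -> nat),
    [/\ forall l, gring_comp (dg l) (x l), forall l, (0 < dg l)%N
      & generates_irrelevant x r].
Proof.
move=> nS; have [|s sP] := nS (fun y => hcomp gS 0 y = 0).
  split=> //; first by rewrite raddf0.
    by move=> y z hy hz; rewrite raddfD /= hy hz addr0.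
  by move=> a y _ hy; rewrite hcomp0M hy mulr0.
have s0 i : (i < size s)%N -> hcomp gS 0 s`_i = 0.
  by move=> si; apply/sP; apply: (@in_span_gen S (nth 0 s)).
have /choice[u uP] i : exists u : seq nat, s`_i = \sum_(m <- u) hcomp gS m s`_i.
  by have [t _ [_ E]] := hcomp_sum gS s`_i; exists t.
pose L := flatten [seq [seq (m, hcomp gS m s`_i) | m <- u i & (0 < m)%N]
                  | i <- iota 0 (size s)].
have LP p : p \in L -> (0 < p.1)%N /\ gring_comp p.1 p.2.
  move=> /flattenP[_ /mapP[i _ ->] /mapP[m]].
  by rewrite mem_filter => /andP[m0 _] -> /=; split=> //; apply: hcompP.
(* Beyond the end of [L] the generator is 0, placed in degree 1 so that all degrees are positive. *)
pose p0 : nat * S := (1%N, 0).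
have LP' l : (0 < (nth p0 L l).1)%N /\
    gring_comp (nth p0 L l).1 (nth p0 L l).2.
  have [lL|lL] := ltnP l (size L); first by apply: LP; apply: mem_nth.
  by rewrite nth_default //=; split=> //; apply: grading0.
exists (size L), (fun l => (nth p0 L l).2),
  (fun l => (nth p0 L l).1).
split=> [l|l|m y m0 ym]; [by case: (LP' l) | by case: (LP' l) |].
have /sP[c ->] : hcomp gS 0 y = 0.
  by rewrite (hcomp_id gS ym) eq_sym (gtn_eqF m0).
apply: in_span_sum => i _; apply: in_spanM; rewrite uP.
rewrite (bigID (fun m => (0 < m)%N)) /= [X in _ + X]big1 ?addr0; last first.
  by move=> k; rewrite -eqn0Ngt => /eqP ->; apply: s0.
rewrite big_seq_cond; apply: in_span_sum => k /andP[ku k0].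
have kL : (k, hcomp gS k s`_i) \in L.
  apply/flattenP; exists [seq (m, hcomp gS m s`_i) | m <- u i & (0 < m)%N].
    by apply/mapP; exists (nat_of_ord i) => //; rewrite mem_iota ltn_ord.
  by apply/mapP; exists k => //; rewrite mem_filter k0.
have := @in_span_gen S (fun l => (nth p0 L l).2) (size L)
  (index (k, hcomp gS k s`_i) L).
by rewrite nth_index // index_mem; apply.
Qed.

End IrrelevantIdeal.

(** The cycles are generated by finitely many [g i], and modulo boundaries only the degree 0 part of
    a coefficient matters, since the [x l] kill homology. So no homology survives above the degrees
    of the components of the [g i]. *)
Lemma Kos_reg_exact (S : gradedRing) (x : nat -> S) (dg : nat -> nat) r :
  noetherian S -> (forall l, gring_comp (dg l) (x l)) ->
  generates_irrelevant x r ->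
  exists e : nat, forall n (z : Kos dg r (gmod_reg S)), e%:Z < n ->
    gmod_comp _ n z -> Kd x z = 0 -> exists y, z = Kd x y.
Proof.
move=> nS xdg xP; set K := Kos dg r (gmod_reg S).
have nK : noetherian_mod K by apply: noetherian_Kos; apply: noetherian_reg.
have [|I [g [gZ gP]]] := nK (fun z => Kd x z = 0).
  split=> [|y z hy hz|a z hz]; first exact: linear0.
    by rewrite linearD /= hy hz addr0.
  by rewrite linearZ /= hz scaler0.
have gK := gmod_grading K; have gS := gring_grading S.
have /choice[d dP] i : exists d : nat, forall n, d%:Z < n -> hcomp gK n (g i) = 0.
  have [s _ [s0 _]] := hcomp_sum gK (g i).
  exists (\max_(m <- s) absz m)%N => n dn; apply: s0; apply/negP => ns.
  have : (`|n| <= \max_(m <- s) `|m|)%N by apply: (@leq_bigmax_seq _ s xpredT absz n).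
  by lia.
exists (\max_i d i)%N => n z en zn dz.
have [c zE] := gP z dz.
pose c0 i := hcomp gS 0 (c i).
(* The coefficient has no degree 0 part, so it is a combination of the [x l], and the homotopies
   [Kh l] give a primitive. *)
have B i : exists y, (c i - c0 i) *: g i = Kd x y.
  have [k ->] : in_span x r (c i - c0 i).
    have y0 : hcomp gS 0 (c i - c0 i) = 0.
      by rewrite raddfB /= (hcomp_id gS (hcompP gS 0 (c i))) eqxx subrr.
    have [s us [_ ->]] := hcomp_sum gS (c i - c0 i).
    apply: in_span_sum => -[|m] _; first by rewrite y0; apply: in_span0.
    by apply: (xP m.+1) => //; apply: hcompP.
  exists (\sum_(l < r) k l *: Kh l (g i)).
  rewrite scaler_suml linear_sum; apply: eq_bigr => l _.
  by rewrite linearZ /= -scalerA (Kd_scale_cycle (ltn_ord l) (gZ i)).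
have [y yP] := choice B.
have E : z = \sum_i c0 i *: g i + Kd x (\sum_i y i).
  rewrite {1}zE linear_sum /= -big_split /=; apply: eq_bigr => i _.
  by rewrite -yP -scalerDl addrC subrK.
(* In degree [n] the terms [c0 i *: g i] have no component, because [c0 i] preserves degrees; only
   the boundary remains. *)
exists (hcomp gK n (\sum_i y i)).
rewrite -(hcomp_map gK gK (q := id) (f := @Kd S x dg r (gmod_reg S))) //;
  last exact: Kd_graded.
have {1}-> : z = hcomp gK n z by rewrite (hcomp_id gK zn) eqxx.
rewrite {1}E raddfD /= raddf_sum big1 ?add0r // => i _ /=.
have h m v : gmod_comp K m v -> gmod_comp K m (c0 i *: v).
  by move=> vm; have := gmod_compZ (hcompP gS 0 (c i)) vm; rewrite add0r.
have -> : hcomp gK n (c0 i *: g i) = c0 i *: hcomp gK n (g i).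
  exact: (hcomp_map gK gK (q := id) (f := GRing.scale (c0 i)) (fun _ _ e => e) h).
by rewrite dP ?scaler0 //; have := @leq_bigmax I d i; lia.
Qed.

(** Each coordinate of [z] is a cycle of degree [n - b j > q] in the Koszul complex of S, hence
    bounds. The primitives are reassembled along the basis and cut down to degree [n]. *)
Lemma Kos_free_exact (S : gradedRing) (x : nat -> S) (dg : nat -> nat) r
    (q : nat) :
  (forall l, gring_comp (dg l) (x l)) ->
  (forall n (z : Kos dg r (gmod_reg S)), q%:Z < n ->
    gmod_comp _ n z -> Kd x z = 0 -> exists y, z = Kd x y) ->
  forall (V : gradedModule S) k (e : 'I_k -> V) (b : 'I_k -> int),
  is_basis e -> (forall j, gmod_comp V (b j) (e j)) ->
  forall n, (forall j, b j + q%:Z < n) ->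
  forall z : Kos dg r V, gmod_comp _ n z -> Kd x z = 0 ->
  exists2 y, gmod_comp (Kos dg r V) n y & Kd x y = z.
Proof.
move=> xdg ex V k e b he eb n bn z zn dz.
pose f j : {linear V -> gmod_reg S} := bcoord he j.
have gL j : linear (GRing.scale^~ (e j) : S^o -> V).
  by move=> a u v; rewrite scalerDl scalerA.
pose g j : {linear gmod_reg S -> V} := HB.pack (GRing.scale^~ (e j) : S^o -> V)
  (GRing.isLinear.Build S S^o V _ _ (gL j)).
have fg v : v = \sum_j g j (f j v) by apply: bcoord_sum.
have /choice[y yP] j : exists y, Kmap (f j) z = Kd x y.
  apply: (ex (n - b j)); first by have := bn j; lia.
    apply: (Kmap_graded (a := - b j)) zn => m v vm.
    exact: (bcoord_graded he eb).
  by rewrite -Kmap_Kd dz linear0.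
have zE : Kd x (\sum_j Kmap (g j) (y j)) = z.
  rewrite [RHS](Kmap_decomp fg) linear_sum; apply: eq_bigr => j _.
  by rewrite yP Kmap_Kd.
have gK := gmod_grading (Kos dg r V).
have zn' : gmod_comp _ n (Kd x (\sum_j Kmap (g j) (y j))) by rewrite zE.
have [v vn vE] := hcomp_pre gK gK (f := @Kd S x dg r V) (Kd_graded xdg (V := V)) zn'.
by exists v => //; rewrite -zE.
Qed.

(** * Degrees of the generators of a minimal resolution *)

Section Zigzag.
Context (S : gradedRing) (x : nat -> S) (dg : nat -> nat) (r : nat).
Context (F : gradedComplex S) (n : int).

Definition Kos_exact_at (i : nat) :=
  forall z : Kos dg r (F i), gmod_comp _ n z -> Kd x z = 0 ->
  exists2 y, gmod_comp (Kos dg r (F i)) n y & Kd x y = z.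

(** One stair of the zigzag: down by the differential of [F], then back along the Koszul
    differential. Projecting the lift to homological degree [t.+1] does no harm, as [Kd] is
    homogeneous. *)
Lemma Koszul_lift s t (w : Kos dg r (F s.+1)) : Kos_exact_at s ->
  gmod_comp _ n w -> Kpi t w = w -> Kd x (Kmap (cplx_d F s) w) = 0 ->
  exists w' : Kos dg r (F s), [/\ gmod_comp _ n w', Kpi t.+1 w' = w'
    & Kd x w' = Kmap (cplx_d F s) w].
Proof.
move=> exK wn wt dw.
have wn' : gmod_comp _ n (Kmap (cplx_d F s) w).
  have := @Kmap_graded S dg r _ _ (cplx_d F s) 0 _ n w; rewrite addr0.
  by apply=> // m v; rewrite addr0; apply: cplx_deg.
have [w' wn'' wE] := exK _ wn' dw.
exists (Kpi t.+1 w'); split; first exact: Kpi_graded.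
  exact: Kpi_idem.
by rewrite -Kpi_Kd wE Kpi_Kmap wt.
Qed.

(* A diagram chase in the double complex F (x) K, from homological degree t of
   K to its top degree r and back. *)
Lemma Koszul_zigzag :
  (forall i v, cplx_d F i v = 0 -> exists u, v = cplx_d F i.+1 u) ->
  forall k s t (w : Kos dg r (F s.+1)), (t + k)%N = r -> (k <= s)%N ->
  (forall i, (i <= s)%N -> Kos_exact_at i) ->
  gmod_comp _ n w -> Kpi t w = w -> Kd x (Kmap (cplx_d F s) w) = 0 ->
  exists v u, w = Kmap (cplx_d F s.+1) v + Kd x u.
Proof.
move=> exF; elim=> [|k IH] s t w tk ks exK wn wt dw.
  have [w' [_ w'i w'E]] := Koszul_lift (exK s (leqnn s)) wn wt dw.
  (* Here [t = r], so the lift would lie above the top homological degree. *)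
  have w'0 : w' = 0 by rewrite -w'i Kpi_large // -tk addn0.
  have [v vE] : exists v, w = Kmap (cplx_d F s.+1) v.
    by apply: Kmap_exact (exF s) _ _; rewrite -w'E w'0 linear0.
  by exists v, 0; rewrite linear0 addr0.
case: s ks w exK wn wt dw => // s ks w exK wn wt dw.
have [w' [w'n w'i w'E]] := Koszul_lift (exK s.+1 (leqnn _)) wn wt dw.
have [|||v [u w'E']] := IH s t.+1 w' _ ks _ w'n w'i.
- by rewrite addSn -tk addnS.
- by move=> i si; apply: exK; apply: leqW.
- by rewrite -Kmap_Kd w'E; apply: Kmap_comp0; exact: cplx_dd.
(* Both [w] and [Kd x v] have image [Kd x w'] under the differential of [F], so exactness of [F]
   applies to their difference. *)
have [v' v'E] : exists v', w - Kd x v = Kmap (cplx_d F s.+2) v'.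
  apply: Kmap_exact (exF s.+1) _ _.
  rewrite linearB /= -w'E w'E' linearD /= Kd_Kd addr0.
  by rewrite -Kmap_Kd subrr.
by exists v', v; rewrite -v'E subrK.
Qed.

End Zigzag.

(** * The homogeneous maximal ideal and minimality *)

Section MaximalIdeal.
Context (S : gradedLocalRing).
Let gS := gring_grading S.

(** The homogeneous maximal ideal as the preimage of [glr_max0] under the ring map S -> S_0, a form
    in which closure under sums and multiples is immediate. *)
Definition in_max (r : S) := glr_max0 (hcomp gS 0 r).

Lemma glr_max_in_max r : glr_max r -> in_max r.
Proof.
have [[_ m0 mD mM] _ _] := glr_max0P S.
move=> [n [c [cS c0 ->]]]; rewrite /in_max.
have -> : \sum_(i < n) c i = \sum_(i <- iota 0 n) c i.
  by rewrite -(big_mkord xpredT c) /index_iota subn0.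
rewrite hcompE ?iota_uniq //.
by case: ifP.
Qed.

Lemma in_max0 : in_max 0.
Proof. by rewrite /in_max raddf0; case: (glr_max0P S) => -[]. Qed.

Lemma in_maxD r s : in_max r -> in_max s -> in_max (r + s).
Proof.
rewrite /in_max raddfD /=; have [[_ _ mD _] _ _] := glr_max0P S; exact: mD.
Qed.

Lemma in_maxM r s : in_max s -> in_max (r * s).
Proof.
rewrite /in_max hcomp0M; have [[_ _ _ mM] _ _] := glr_max0P S.
by apply: mM; apply: hcompP.
Qed.

Lemma in_max1 : ~ in_max 1.
Proof.
by rewrite /in_max (hcomp_id gS (gring_comp1 S)) eqxx; case: (glr_max0P S).
Qed.

Lemma in_max_pos n r : (0 < n)%N -> gring_comp n r -> in_max r.
Proof.
move=> n0 rn; rewrite /in_max (hcomp_id gS rn) eq_sym gtn_eqF //.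
by case: (glr_max0P S) => -[].
Qed.

Context (V : lmodType S) (k : nat) (e : 'I_k -> V) (he : is_basis e).

(* the submodule m V *)
Definition in_maxV (v : V) := forall j, in_max (bcoord he j v).

Lemma in_maxVD u v : in_maxV u -> in_maxV v -> in_maxV (u + v).
Proof. by move=> hu hv j; rewrite linearD; apply: in_maxD (hu j) (hv j). Qed.

Lemma in_maxVZ r v : in_max r -> in_maxV (r *: v).
Proof. by move=> hr j; rewrite linearZ /= [_ *: _]mulrC; apply: in_maxM. Qed.

Lemma in_maxV_sum n (r : nat -> S) (v : nat -> V) :
  (forall i, in_max (r i)) -> in_maxV (\sum_(i < n) r i *: v i).
Proof.
move=> hr; elim/big_ind: _ => [j||i _].
- by rewrite linear0; apply: in_max0.
- exact: in_maxVD.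
- exact: in_maxVZ.
Qed.

Lemma basis_notin_maxV j : ~ in_maxV (e j).
Proof. by move=> /(_ j); rewrite bcoord_basis eqxx; apply: in_max1. Qed.

End MaximalIdeal.

Lemma diff_in_maxV (S : gradedLocalRing) (M : gradedModule S)
    (F : gradedComplex S) (eps : {linear F 0%N -> M}) i k (e : 'I_k -> F i)
    (he : is_basis e) : is_min_resolution eps ->
  forall u, in_maxV he (cplx_d F i u).
Proof.
move=> mF u; have [n [r [y [rm ->]]]] := mres_min mF u.
by apply: in_maxV_sum => l; apply: glr_max_in_max.
Qed.

(** By induction on [i]: a generator violating the bound has a degree in which the Koszul complexes
    of all earlier F_s are exact, and the zigzag then contradicts minimality. *)
Lemma resolution_linear_growth (S : gradedLocalRing) (M : gradedModule S)
    (F : gradedComplex S) (eps : {linear F 0%N -> M}) :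
  noetherian S -> is_min_resolution eps ->
  forall (k : nat -> nat) (e : forall i, 'I_(k i) -> F i)
    (b : forall i, 'I_(k i) -> int),
  (forall i, is_basis (e i)) ->
  (forall i j, gmod_comp (F i) (b i j) (e i j)) ->
  exists c d : nat, forall i j, b i j <= (c * i + d)%N%:Z.
Proof.
move=> nS mF k e b he eb.
have [r [x [dg [xdg dg0 xP]]]] := irrelevant_generators nS.
have [q qP] := Kos_reg_exact nS xdg xP.
(* The zigzag descends [r] steps in [F], so F_0, ..., F_r are covered by [d] instead. The slope
   [q.+1] puts a violating degree more than [q] above all earlier generators. *)
pose d := (\max_(i < r.+1) \max_j absz (b i j))%N.
have exF i v : cplx_d F i v = 0 -> exists u, v = cplx_d F i.+1 u.
  by move/(mres_exact mF).
exists q.+1, d; elim/ltn_ind => i IH j.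
have [ir|ri] := leqP i r.
  have h1 : (\max_j absz (b i j) <= d)%N.
    have ir' : (i < r.+1)%N by [].
    exact: (@leq_bigmax _ (fun i : 'I_r.+1 => \max_j absz (b i j))%N (Ordinal ir')).
  have h2 := @leq_bigmax _ (fun j => absz (b i j)) j.
  by move: (leq_trans h2 h1); lia.
case: i ri j IH => // i ri j IH; rewrite leNgt; apply/negP => bij.
have exK s : (s <= i)%N -> Kos_exact_at x dg r F (b i.+1 j) s.
  move=> si; apply: (Kos_free_exact xdg qP (he s) (eb s)) => l.
  by have := IH s si l; move: bij si; nia.
have [|||v [u E]] := Koszul_zigzag exF (w := Kin dg r (e i.+1 j)) (add0n r) ri exK.
- exact: Kin_graded.
- exact: Kpi_Kin.
- by rewrite -Kmap_Kd Kd_Kin linear0.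
apply: (@basis_notin_maxV _ _ _ _ (he i.+1) j).
(* In homological degree 0 the basis element becomes a boundary of [F] plus a combination with
   coefficients [x l]; both lie in m F_(i+1). *)
rewrite -(Kout_Kin dg r (e i.+1 j)) E KoutD Kout_Kmap.
apply: in_maxVD; first exact: diff_in_maxV mF _.
have [y ->] := Kout_Kd x u.
by apply: in_maxV_sum => l; apply: in_max_pos (dg0 l) (xdg l).
Qed.

Lemma blin_graded (S : gradedRing) (V W : gradedModule S) k (e : 'I_k -> V)
    (he : is_basis e) (b : 'I_k -> int) (y : 'I_k -> W) (c : int) :
  (forall j, gmod_comp V (b j) (e j)) ->
  (forall j, gmod_comp W (b j + c) (y j)) ->
  forall n v, gmod_comp V n v -> gmod_comp W (n + c) (blin he y v).
Proof.
move=> eb yb n v vn; apply: (grading_sum (gmod_grading W)) => j _.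
have := bcoord_graded he eb vn j; move: (yb j); rewrite /=.
case E: (n - b j) => [m|m] yj; last first.
  by move=> ->; rewrite scale0r; apply: (grading0 (gmod_grading W)).
move=> cj; have := gmod_compZ cj yj; rewrite -E.
by congr (gmod_comp W _ _); lia.
Qed.

(** S has no negative degrees, so [V] is 0 below its generators. *)
Lemma graded_free_lower_bound (S : gradedRing) (V : gradedModule S) k
    (e : 'I_k -> V) (b : 'I_k -> int) (beta : int) :
  is_basis e -> (forall j, gmod_comp V (b j) (e j)) ->
  (forall j, beta <= b j) ->
  forall n v, gmod_comp V n v -> v <> 0 -> beta <= n.
Proof.
move=> he eb bb n v vn v0; rewrite leNgt; apply/negP => nb; apply: v0.
rewrite (bcoord_sum he v) big1 // => j _.
have := bcoord_graded he eb vn j; rewrite /=.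
case E: (n - b j) => [m|m]; first by have := bb j; lia.
by move=> ->; rewrite scale0r.
Qed.

(** A basis element mapping to 0 would be a boundary, hence in m F_i, which is impossible. So its
    image is a nonzero element of the same degree in the previous module. *)
Lemma resolution_lower_bound (S : gradedLocalRing) (M : gradedModule S)
    (F : gradedComplex S) (eps : {linear F 0%N -> M}) (beta : int) :
  is_min_resolution eps ->
  (forall n y, gmod_comp M n y -> y <> 0 -> beta <= n) ->
  forall (k : nat -> nat) (e : forall i, 'I_(k i) -> F i)
    (b : forall i, 'I_(k i) -> int),
  (forall i, is_basis (e i)) ->
  (forall i j, gmod_comp (F i) (b i j) (e i j)) ->
  forall i j, beta <= b i j.
Proof.
move=> mF Mb k e b he eb; elim=> [|i IH] j.
  apply: (Mb _ (eps (e 0%N j))); first exact: (mres_aug mF (eb 0%N j)).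
  move/(mres_exact0 mF) => [u eE].
  apply: (@basis_notin_maxV _ _ _ _ (he 0%N) j).
  by rewrite eE; apply: diff_in_maxV mF _.
apply: (graded_free_lower_bound (he i) (eb i) IH (cplx_deg (eb i.+1 j))).
move/(mres_exact mF) => [u eE].
apply: (@basis_notin_maxV _ _ _ _ (he i.+1) j).
by rewrite eE; apply: diff_in_maxV mF _.
Qed.

(** * Modules of finite length live in bounded degrees *)

Section BoundedDegrees.
Context (S : gradedRing) (M : gradedModule S).
Let gM := gmod_grading M.

Definition gmod_ge (t : int) : set M := fun v => forall n, n < t -> hcomp gM n v = 0.

Lemma gmod_ge_submodule t : is_submodule (gmod_ge t).
Proof.
split=> [n _|u v hu hv n nt|r v hv n nt]; first by rewrite raddf0.
  by rewrite raddfD /= hu // hv // addr0.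
have [s us [s0 ->]] := hcomp_sum (gring_grading S) r.
rewrite scaler_suml raddf_sum big1 //= => i _.
set c := hcomp _ i r.
have h m w : gmod_comp M m w -> gmod_comp M (i%:Z + m) (c *: w).
  by move=> wm; apply: gmod_compZ => //; apply: hcompP.
have := hcomp_map gM gM (f := GRing.scale c) (@addrI _ i%:Z) h (n - i%:Z) v.
rewrite addrC subrK => E; rewrite [LHS]E hv ?raddf0 //.
by lia.
Qed.

(** If nonzero elements occurred in unbounded degrees, the truncations [gmod_ge] would form strict
    chains of any length. *)
Lemma finite_length_bounded : finite_length M ->
  exists B : nat, forall n v, gmod_comp M n v -> v <> 0 -> `|n| <= B%:Z.
Proof.
move=> [l lP]; apply: contrapT => nB.
have step (B : nat) : exists n, (exists2 v, gmod_comp M n v & v <> 0) /\ B%:Z < `|n|.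
  apply: contrapT => nn; apply: nB; exists B => n v vn v0.
  by rewrite leNgt; apply/negP => bn; apply: nn; exists n; split=> //; exists v.
(* The [l.+2] degrees, sorted decreasingly so that truncations increase, give [l.+1] strict
   inclusions, one too many. *)
have [s [us ss sP]] : exists s : seq int, [/\ uniq s, size s = l.+2
    & forall n, n \in s -> exists2 v, gmod_comp M n v & v <> 0].
  elim: l.+2 => [|k [s [us ss sP]]]; first by exists [::].
  have [n [nv nB']] := step (\max_(m <- s) absz m)%N.
  exists (n :: s); split; rewrite /= ?ss ?us ?andbT //.
    apply/negP => ns.
    have : (absz n <= \max_(m <- s) absz m)%N.
      exact: (@leq_bigmax_seq _ s xpredT absz n).
    by lia.
  by move=> m; rewrite inE => /orP[/eqP ->|/sP].
pose t := sort (fun m n : int => n <= m) s.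
have st : size t = l.+2 by rewrite size_sort.
have tP i : (i < l.+1)%N -> t`_i.+1 < t`_i.
  move=> il.
  have tS : sorted (fun m n : int => n <= m) t.
    by apply: sort_sorted => m n; apply: le_total.
  have ge : t`_i.+1 <= t`_i.
    by apply: (sortedP 0 tS); rewrite st.
  rewrite lt_neqAle ge andbT.
  rewrite nth_uniq ?sort_uniq ?st ?eqn_leq ?ltnn //.
  by apply: leqW.
have := lP l.+1 (fun i => gmod_ge t`_i); rewrite ltnn => H.
suff : false by []. apply: H => [i _|i il]; first exact: gmod_ge_submodule.
split=> [v hv n nt|/(_ _) H].
  by apply: hv; apply: lt_trans nt (tP i il).
have [|v vn v0] := sP t`_i.+1.
  by rewrite -(mem_sort (fun m n : int => n <= m)); apply: mem_nth; rewrite st.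
have : gmod_ge t`_i v.
  apply: H => n nt; rewrite (hcomp_id gM vn).
  by case: eqP => // e; rewrite e ltxx in nt.
move=> /(_ _ (tP i il)); rewrite (hcomp_id gM vn) eqxx.
exact: v0.
Qed.

End BoundedDegrees.

(** * Morphisms from a fold *)

Section DsumEval.
Context (R : nzRingType) (G : nat -> lmodType R) (W : lmodType R).
Context (f : forall i, {linear G i -> W}).

Definition dsum_eval (v : dsum G) : W :=
  \sum_(i < projT1 (cid (dsum_fin v))) f i (v i).

(** Any bound on the support gives the same sum as the bound chosen in [dsum_eval]. *)
Lemma dsum_evalE (v : dsum G) m : (forall i, (m <= i)%N -> v i = 0) ->
  dsum_eval v = \sum_(i < m) f i (v i).
Proof.
move=> vm; rewrite /dsum_eval; case: cid => k /= vk.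
have E p : (forall i, (p <= i)%N -> v i = 0) ->
    \sum_(i < p) f i (v i) = \sum_(i < k + m | (i < p)%N) f i (v i).
  move=> vp; rewrite [RHS]big_mkcond /=.
  rewrite -(big_mkord xpredT (fun i => f i (v i))).
  rewrite -(big_mkord xpredT (fun i => if (i < p)%N then f i (v i) else 0)).
  have [pk|/ltnW pk] := leqP p (k + m).
    rewrite (big_cat_nat (leq0n p) pk) /= [X in _ + X]big1_seq ?addr0.
      by apply: eq_big_nat => i /andP[_ ->].
    move=> i /andP[_]; rewrite mem_index_iota => /andP[pi _].
    by rewrite ltnNge pi.
  rewrite (big_cat_nat (leq0n _) pk) /= [X in _ + X]big1_seq ?addr0.
    by apply: eq_big_nat => i /andP[_ ik]; rewrite (leq_trans ik pk).
  move=> i /andP[_]; rewrite mem_index_iota => /andP[pi _].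
  by rewrite vk ?linear0 // (leq_trans _ pi) // leq_addr.
rewrite (E k) // (E m) // [LHS]big_mkcond [RHS]big_mkcond /=.
apply: eq_bigr => i _; have [ik|/vk ->] := ltnP i k.
  by case: ltnP => // /vm ->; rewrite linear0.
by rewrite linear0; case: ltnP.
Qed.

Lemma dsum_eval_linear : linear dsum_eval.
Proof.
move=> r u v; have [m um] := dsum_fin u; have [k vk] := dsum_fin v.
have h1 i : (maxn m k <= i)%N -> u i = 0 by rewrite geq_max => /andP[/um].
have h2 i : (maxn m k <= i)%N -> v i = 0 by rewrite geq_max => /andP[_ /vk].
rewrite (dsum_evalE h1) (dsum_evalE h2) (@dsum_evalE _ (maxn m k)); last first.
  by move=> i hi; rewrite /= h1 // h2 // scaler0 addr0.
rewrite scaler_sumr -big_split /=; apply: eq_bigr => i _.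
by rewrite linearP.
Qed.

HB.instance Definition _ :=
  GRing.isLinear.Build R (dsum G) W _ dsum_eval dsum_eval_linear.

End DsumEval.

Section FoldMorphism.
Context (S : gradedRing) (a : int) (F : gradedComplex S) (D : diffModule S a).
Context (k : nat -> nat) (e : forall i, 'I_(k i) -> F i).
Context (b : forall i, 'I_(k i) -> int).
Arguments e : clear implicits.
Arguments b : clear implicits.
Hypothesis he : forall i, is_basis (e i).
Hypothesis eb : forall i j, gmod_comp (F i) (b i j) (e i j).
Arguments he : clear implicits.
Arguments eb : clear implicits.
Let gD := gmod_grading D.

(** This says that [f] is a degree 0 map from F_i(ia) to [D]. *)
Definition deg_map i (f : F i -> D) :=
  forall n v, gmod_comp (F i) (n + i%:Z * a) v -> gmod_comp D n (f v).

(** The vanishing of the obstruction to extending the family of maps from F_i to F_(i+1). *)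
Definition bounds i (f : F i -> D) :=
  forall v, exists y, f (cplx_d F i v) = dmod_d D y.

Lemma blin_deg_map i (y : 'I_(k i) -> D) :
  (forall j, gmod_comp D (b i j - i%:Z * a) (y j)) -> deg_map (blin (he i) y).
Proof.
move=> yb n v vn; rewrite -[n](addrK (i%:Z * a)).
exact: (blin_graded (he i) (c := - (i%:Z * a)) (eb i) yb vn).
Qed.

Lemma homology_comp0_boundary n (z : D) :
  (forall h, homology_comp (D := D) n h -> h = 0) ->
  gmod_comp D n z -> dmod_d D z = 0 -> exists y, z = dmod_d D y.
Proof.
move=> H0 zn dz; have zc : z \in cycle_pred D by apply/eqP.
have /homology_classE[y] : homology_class (Cycle zc) = homology_class 0.
  by rewrite homology_class0; apply: (H0); exists (Cycle zc).
by rewrite subr0 => zE; exists y.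
Qed.

(* The next map g exists because f (d _) bounds; the classes of the cycles
   g (d _) lie in degrees where H(D) vanishes, so g (d _) bounds as well. *)
Lemma extend_map i (f : {linear F i -> D}) :
  (forall j n, n = b i.+2 j - i.+1%:Z * a ->
     forall h, homology_comp (D := D) n h -> h = 0) ->
  deg_map f -> bounds f ->
  exists g : {linear F i.+1 -> D}, [/\ deg_map g, bounds g
    & forall v, dmod_d D (g v) = f (cplx_d F i v)].
Proof.
move=> H0 fdeg fb.
have /choice[y yP] j : exists y, gmod_comp D (b i.+1 j - i.+1%:Z * a) y /\
    dmod_d D y = f (cplx_d F i (e i.+1 j)).
  have [y yE] := fb (e i.+1 j).
  have fe : gmod_comp D (b i.+1 j - i%:Z * a) (f (cplx_d F i (e i.+1 j))).
    by apply: fdeg; rewrite subrK; apply: cplx_deg.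
  have fe' : gmod_comp (gmod_shift a D) (b i.+1 j - i.+1%:Z * a) (dmod_d D y).
    rewrite /= -yE; move: fe; congr (gmod_comp D _ _); lia.
  (* A homogeneous primitive is needed for [g] to be a [deg_map]; since d raises degrees by [a], its
     degree involves (i+1)a. *)
  have [y' y'n y'E] := hcomp_pre gD (gmod_grading (gmod_shift a D))
    (f := dmod_d D) (@dmod_deg _ _ D) fe'.
  by exists y'; rewrite y'E yE.
pose g : {linear F i.+1 -> D} := blin (he i.+1) y.
have gdeg : deg_map g by apply: blin_deg_map => j; case: (yP j).
have gd v : dmod_d D (g v) = f (cplx_d F i v).
  rewrite [in RHS](bcoord_sum (he i.+1) v) /= !linear_sum; apply: eq_bigr => j _.
  by rewrite !linearZ /=; case: (yP j) => _ ->.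
exists g; split=> // v.
have /choice[z zP] j : exists z, g (cplx_d F i.+1 (e i.+2 j)) = dmod_d D z.
  apply: (homology_comp0_boundary (H0 j _ erefl)).
    by apply: gdeg; rewrite subrK; apply: cplx_deg.
  by rewrite gd cplx_dd linear0.
exists (blin (he i.+2) z v).
rewrite {1}(bcoord_sum (he i.+2) v) !linear_sum; apply: eq_bigr => j _.
by rewrite !linearZ /= zP.
Qed.

Lemma fold_maps (f0 : {linear F 0%N -> D}) :
  (forall i j n, n = b i.+2 j - i.+1%:Z * a ->
     forall h, homology_comp (D := D) n h -> h = 0) ->
  deg_map f0 -> bounds f0 ->
  exists f : forall i, {linear F i -> D},
    [/\ f 0%N = f0, forall i, deg_map (f i), forall i, bounds (f i)
      & forall i v, dmod_d D (f i.+1 v) = f i (cplx_d F i v)].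
Proof.
move=> H0 f0deg f0b.
(* The invariants travel with the map, so that each stage of the recursion can be extended again. *)
pose T i := {f : {linear F i -> D} | deg_map f /\ bounds f}.
have step i (f : T i) : exists g : T i.+1,
    forall v, dmod_d D (sval g v) = sval f (cplx_d F i v).
  case: f => f [fdeg fb] /=.
  by have [g [gdeg gb gE]] := extend_map (H0 i) fdeg fb;
    exists (exist _ g (conj gdeg gb)).
pose next i f := projT1 (cid (step i f)).
pose f := nat_rect T (exist _ f0 (conj f0deg f0b)) next.
exists (fun i => sval (f i)); split=> // [i|i|i v].
- by case: (svalP (f i)).
- by case: (svalP (f i)).
- exact: (projT2 (cid (step i (f i)))).
Qed.

End FoldMorphism.

(** * Quasi-isomorphisms from the folded resolution *)

Lemma graded_iso_comp (S : gradedRing) (M N : gradedModule S)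
    (phi : {linear M -> N}) : bijective phi -> graded_map phi ->
  forall n x, gmod_comp N n (phi x) -> gmod_comp M n x.
Proof.
move=> /bij_inj phiI phig n x xn.
have [y yn /phiI <- //] := hcomp_pre (gmod_grading M) (gmod_grading N) phig xn.
Qed.

(** Surjectivity on homology comes from F_0, since [eps] is onto. For a cycle v, the entries of
    positive index are boundaries of [F], so their images bound; if g v bounds too, so does f_0 v_0,
    whence eps v_0 = 0 and v_0 is a boundary as well. *)
Lemma fold_quasi_iso (S : gradedLocalRing) (M : gradedModule S) (a : int)
    (F : gradedComplex S) (eps : {linear F 0%N -> M}) (D : diffModule S a)
    (phi : {linear ghomology D -> M}) (f : forall i, {linear F i -> D}) :
  is_min_resolution eps -> bijective phi ->
  (forall i, deg_map (f i)) -> (forall i, bounds (f i)) ->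
  (forall i v, dmod_d D (f i.+1 v) = f i (cplx_d F i v)) ->
  (forall v, exists z : cycles D, cycle_val z = f 0%N v /\
     phi (homology_class z) = eps v) ->
  exists g : dmod_mor (fold a F) D, quasi_iso g.
Proof.
move=> mF phib fdeg fb fd f0.
pose g : {linear fold a F -> D} := dsum_eval (G := fun i => gmod_sort (F i)) f.
have gE (v : fold a F) m : (forall i, (m <= i)%N -> dsum_fun v i = 0) ->
    g v = \sum_(i < m) f i (dsum_fun v i).
  exact: dsum_evalE.
have gg : graded_map g.
  move=> n v vn; apply: (grading_sum (gmod_grading D)) => i _.
  exact: (fdeg i n _ (vn i)).
have gd v : g (dmod_d (fold a F) v) = dmod_d D (g v).
  have [m vm] := dsum_fin v.
  rewrite (gE v m.+1); last by move=> i mi; apply: vm; apply: ltnW.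
  rewrite (gE _ m); last first.
    by move=> i mi /=; rewrite vm ?linear0 // leqW.
  rewrite linear_sum big_ord_recl /=.
  have [z [<- _]] := f0 (dsum_fun v 0%N).
  have -> : dmod_d D (cycle_val z) = 0 by apply/eqP; case: z.
  by rewrite add0r; apply: eq_bigr => i _; rewrite fd.
exists (DmodMor gg gd).
have phiI := bij_inj phib.
have g0 (x : F 0%N) : exists v : fold a F,
    [/\ dsum_fun v 0%N = x, dmod_d (fold a F) v = 0 & g v = f 0%N x].
  have fin : exists n, forall i, (n <= i)%N ->
      (match i as i return F i with 0%N => x | _.+1 => 0 end) = 0.
    by exists 1%N => -[].
  pose v : fold a F := DSum (F := fun i => gmod_sort (F i)) fin.
  exists v; split=> //; first by apply: dsumP => i; rewrite /= linear0.
  by rewrite (gE v 1%N) ?big_ord1 // => -[].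
suff [hI hS] : injective (homology_map (DmodMor gg gd)) /\
    forall h, exists h', homology_map (DmodMor gg gd) h' = h.
  have [inv invP] := choice hS.
  by exists inv => // h; apply: hI; rewrite invP.
split.
  move=> h h'; rewrite -(homology_classP h) -(homology_classP h').
  move: (repr h) (repr h') => z w {h h'}.
  rewrite !homology_mapE => /homology_classE[y /= yE].
  apply/homology_classE.
  have [v vE] : exists v : fold a F, v = cycle_val z - cycle_val w by eexists.
  have gv : g v = dmod_d D y by rewrite vE linearB.
  have dv : dmod_d (fold a F) v = 0.
    have dz (c : cycles (fold a F)) : dmod_d (fold a F) (cycle_val c) = 0.
      by apply/eqP; case: c.
    by rewrite vE linearB /= (dz z) (dz w) subrr.
  rewrite -vE; have [m vm] := dsum_fin v.
  have dvi i : cplx_d F i (dsum_fun v i.+1) = 0.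
    by rewrite -[LHS]/(dsum_fun (dmod_d (fold a F) v) i) dv.
  have [u0 u0E] : exists u, dsum_fun v 0%N = cplx_d F 0 u.
    apply/(mres_exact0 mF).
    have [z0 [z0E <-]] := f0 (dsum_fun v 0%N).
    suff -> : homology_class z0 = 0 by rewrite linear0.
    rewrite -(homology_class0 D); apply/homology_classE; rewrite subr0 z0E.
    have /choice[t tP] i : exists t, f i.+1 (dsum_fun v i.+1) = dmod_d D t.
      have /(mres_exact mF)[u ->] := dvi i; exact: fb.
    exists (y - \sum_(i < m) t i); rewrite linearB linear_sum /= -gv.
    rewrite (gE v m.+1); last by move=> i mi; apply: vm; apply: ltnW.
    rewrite big_ord_recl /=; apply/eqP; rewrite eq_sym subr_eq; apply/eqP.
    by congr (_ + _); apply: eq_bigr => i _; rewrite -tP.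
  (* Taking the primitive 0 of 0 ensures that the family of primitives has finite support. *)
  have uP i : exists u, dsum_fun v i = cplx_d F i u /\ (dsum_fun v i = 0 -> u = 0).
    have [v0|v0] := pselect (dsum_fun v i = 0); first by exists 0; rewrite linear0.
    suff [u uE] : exists u, dsum_fun v i = cplx_d F i u by exists u.
    case: i v0 => [|i] v0; first by exists u0.
    exact/(mres_exact mF)/dvi.
  pose u i := projT1 (cid (uP i)).
  pose u' i : F i := match i as i return F i with 0%N => 0 | i.+1 => u i end.
  have fin : exists n, forall i, (n <= i)%N -> u' i = 0.
    exists m.+1 => -[|i] //= mi; rewrite /u; case: cid => t /= [_]; apply.
    exact: vm.
  exists (DSum (F := fun i => gmod_sort (F i)) fin); apply: dsumP => i /=.
  by rewrite /u; case: cid => t /= [].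
move=> h; have [x xE] := mres_surj mF (phi h).
have [v [v0 dv gv]] := g0 x.
have vc : v \in cycle_pred (fold a F) by apply/eqP.
exists (homology_class (Cycle vc)); rewrite homology_mapE.
have [z [zE pz]] := f0 x.
have <- : homology_class z = h by apply: phiI; rewrite pz xE.
by congr homology_class; apply: val_inj; rewrite /= zE.
Qed.

(** Since c(i+2) + d <= (2c+d)(i+1), |n| is at most the larger of B and (2c+d)(i+1), while (i+1)|a|
    exceeds (2c+d+2B)(i+1). The bound on |a| is therefore uniform in i. *)
Lemma obstruction_degree_bound (B c d i : nat) (a n : int) :
  (2 * c + d + 2 * B)%N%:Z < `|a| -> - B%:Z <= n ->
  n <= (c * i.+2 + d)%N%:Z -> B%:Z < `|n - i.+1%:Z * a|.
Proof.
move=> aN nB nc.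
have h : i.+1%:Z * (2 * c + d + 2 * B).+1%:Z <= i.+1%:Z * `|a|.
  by apply: ler_wpM2l => //; lia.
by have [a0|a0] := leP 0 a; nia.
Qed.

(** Homogeneous cycles representing the classes of the [eps (e j)] are chosen on the basis and
    extended linearly. *)
Lemma graded_augmentation_lift (S : gradedRing) (M : gradedModule S) (a : int)
    (D : diffModule S a) (phi : {linear ghomology D -> M})
    (V : gradedModule S) k (e : 'I_k -> V) (b : 'I_k -> int)
    (eps : {linear V -> M}) :
  bijective phi -> graded_map phi -> is_basis e ->
  (forall j, gmod_comp V (b j) (e j)) -> graded_map eps ->
  exists f : {linear V -> D}, graded_map f /\
    forall v, exists z : cycles D, cycle_val z = f v /\
      phi (homology_class z) = eps v.
Proof.
move=> phib phig he eb epsg; have [psi _ phiK] := phib.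
have /choice[z zP] j : exists z : cycles D, gmod_comp D (b j) (cycle_val z) /\
    phi (homology_class z) = eps (e j).
  have hj : gmod_comp M (b j) (phi (psi (eps (e j)))).
    by rewrite phiK; apply: epsg.
  have [z [zb zE]] := graded_iso_comp phib phig hj.
  by exists z; rewrite -zE phiK.
exists (blin he (fun j => cycle_val (z j))); split.
  move=> n v vn; rewrite -[n]addr0.
  apply: (blin_graded he (c := 0) eb) vn => j.
  by rewrite addr0; case: (zP j).
move=> v; exists (blin he z v); split; first exact: cycle_val_sum.
rewrite /blin homology_class_sum linear_sum {2}(bcoord_sum he v) linear_sum.
apply: eq_bigr => j _; rewrite [in RHS]linearZ -(proj2 (zP j)) -linearZ.
by rewrite -homology_scaleE.
Qed.

Theorem theorem1p8 (S : gradedLocalRing) (M : gradedModule S)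
    (F : gradedComplex S) :
  noetherian S -> fin_gen M -> finite_length M ->
  min_free_resolution M F ->
  exists N : int, forall a : int, N < `|a| ->
    forall D : diffModule S a, fin_free D ->
      graded_iso (ghomology D) M ->
      quasi_isomorphic D (fold a F).
Proof.
move=> nS _ fM [eps mF].
have [B BP] := finite_length_bounded fM.
pose k i := projT1 (cid (mres_free mF i)).
have kP i := projT2 (cid (mres_free mF i)).
pose e i := projT1 (cid (kP i)).
have eP i := projT2 (cid (kP i)).
pose b i := projT1 (cid (eP i)).
have bP i := projT2 (cid (eP i)).
have he i : is_basis (e i) := proj1 (bP i).
have eb i j : gmod_comp (F i) (b i j) (e i j) := proj2 (bP i) j.
have bB i j : - B%:Z <= b i j.
  apply: (resolution_lower_bound mF _ he eb) => n y yn y0.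
  by have := BP n y yn y0; lia.
have [c [d bcd]] := resolution_linear_growth nS mF he eb.
exists (2 * c + d + 2 * B)%N%:Z => a aN D _ [phi [phib phig]].
have [f0 [f0g f0P]] :=
  graded_augmentation_lift phib phig (he 0%N) (eb 0%N) (mres_aug mF).
(* As [eps] kills boundaries of [F], the cycles f_0 (d v) have zero class in H(D). *)
have f0b : bounds f0.
  move=> v; have [z [<- zE]] := f0P (cplx_d F 0 v).
  have /homology_classE[y] : homology_class z = homology_class 0.
    apply: (bij_inj phib); rewrite zE homology_class0 linear0.
    by apply/(mres_exact0 mF); exists v.
  by rewrite subr0; exists y.
(* H(D) is isomorphic to [M], which is 0 in degrees of absolute value above [B], and all these
   obstruction degrees lie there. *)
have H0 i j n : n = b i.+2 j - i.+1%:Z * a ->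
    forall h, homology_comp (D := D) n h -> h = 0.
  move=> nE h hn; apply: contrapT => h0.
  have := obstruction_degree_bound aN (bB i.+2 j) (bcd i.+2 j).
  rewrite -nE ltNge; apply/negP; rewrite negbK.
  apply: (BP n (phi h) (phig n h hn)) => ph; apply: h0.
  by apply: (bij_inj phib); rewrite linear0.
have [|f [f0E fdeg fb fd]] := fold_maps he eb H0 _ f0b.
  by move=> n v; rewrite mul0r addr0; apply: f0g.
have [|g gq] := fold_quasi_iso mF phib fdeg fb fd; first by rewrite f0E.
(* The quasi-isomorphism goes from the fold to [D], hence the symmetry. *)
by apply/rst_sym/rst_step; exists g.
Qed.
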